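(* Up to renaming of the colors (by a bijection of alphabets), the minimal non-foot-sortable 2-bounded sock orderings are exactly the following $14$ sporadic sock orderings together with the members of the following $4$ infinite families. Sporadic sock orderings (distinct letters denote distinct colors): $abcdbacd$, $abcdedabc$; $abcadbdc$, $abcbdadc$, $abcdbadc$, $abcdcadb$, $abcdceaeb$, $abcdedacb$; $abcdbcad$, $abcdcbad$, $abcdedbac$; $abcabdedc$, $abcdadedc$, $abcdcaefeb$. Infinite families (where $x,y,z,a_0,a_1,\ldots,a_{n-1}$ denote pairwise distinct colors, and in each case the final part ''$a_{n-2}a_{n-1}a_{n-3}a_{n-2}\cdots a_0a_1$'' denotes the concatenation of the two-letter words $a_{i}a_{i+1}$ for $i=n-2,n-3,\ldots,0$ in this order): (A) $x\,a_0\,y\,a_{n-1}\,x\,a_{n-2}a_{n-1}a_{n-3}a_{n-2}\cdots a_0a_1$ for $n\ge 2$; (B) $a_0\,x\,y\,a_{n-1}\,x\,y\,a_{n-2}a_{n-1}a_{n-3}a_{n-2}\cdots a_0a_1$ for $n\ge 3$; (B') $a_0\,y\,x\,a_{n-1}\,x\,y\,a_{n-2}a_{n-1}a_{n-3}a_{n-2}\cdots a_0a_1$ for $n\ge 3$; (C) $a_0\,x\,a_{n-1}\,y\,z\,y\,x\,a_{n-2}a_{n-1}a_{n-3}a_{n-2}\cdots a_0a_1$ for $n\ge 3$.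
   Context: A sock ordering is a finite string $s_1s_2\cdots s_n$ of letters; each entry is a sock and its letter is its color. Sorting with a stack (one foot): the socks are read from left to right and each is pushed onto the top of a stack; at any time the top sock of the stack may be popped and appended to the output; at the end all socks have been output. A sock ordering is foot-sortable if the stack operations can be chosen so that in the output the socks of each color form a contiguous block. A sock ordering is 2-bounded if each color appears in it at most twice. A non-foot-sortable sock ordering is minimal if deleting any single sock makes it foot-sortable.
   Formalization: The sporadic ordering abcdadedc is replaced by abcbadedc: as printed it contains the color d three times, so it is not 2-bounded, while abcbadedc is a minimal non-foot-sortable 2-bounded ordering missing from the printed list. *)

(* Defs.v *)
From mathcomp Require Import all_boot.

Set Implicit Arguments.
Unset Strict Implicit.
Unset Printing Implicit Defensive.

Section SockOrderings.

Variable T : eqType.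
Implicit Types (s out : seq T).

(* [foot_run s st out]: with [s] still to be read and [st] on the stack (top
   first), some sequence of pushes and pops outputs exactly [out] and ends with
   no sock left. *)
Inductive foot_run : seq T -> seq T -> seq T -> Prop :=
| foot_done : foot_run [::] [::] [::]
| foot_push x s st out : foot_run s (x :: st) out -> foot_run (x :: s) st out
| foot_pop x s st out : foot_run s st out -> foot_run s (x :: st) (x :: out).

Definition color_sorted out : Prop :=
  forall c : T, exists (u v : seq T) (k : nat),
    [/\ out = u ++ nseq k c ++ v, c \notin u & c \notin v].

Definition foot_sortable s : Prop :=
  exists2 out : seq T, foot_run s [::] out & color_sorted out.

Definition two_bounded s : Prop := forall c : T, count_mem c s <= 2.

Definition minimal_non_foot_sortable s : Prop :=
  ~ foot_sortable s /\
  (forall (u v : seq T) (x : T), s = u ++ x :: v -> foot_sortable (u ++ v)).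

End SockOrderings.

(* [f] restricts to a bijection from the letters of [w] to those of [s]. *)
Definition renaming (T U : eqType) (w : seq T) (s : seq U) : Prop :=
  exists2 f : T -> U, {in w &, injective f} & s = map f w.

(* [abcbadedc] corrects a misprint in the source list, which has [abcdadedc]
   there: that word is not 2-bounded (three [d]'s) and is foot-sortable. *)
Definition sporadic : seq (seq nat) :=
  let: (a, b, c, d, e, f) := (0, 1, 2, 3, 4, 5) in
  [:: [:: a; b; c; d; b; a; c; d];
      [:: a; b; c; d; e; d; a; b; c];
      [:: a; b; c; a; d; b; d; c];
      [:: a; b; c; b; d; a; d; c];
      [:: a; b; c; d; b; a; d; c];
      [:: a; b; c; d; c; a; d; b];
      [:: a; b; c; d; c; e; a; e; b];
      [:: a; b; c; d; e; d; a; c; b];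
      [:: a; b; c; d; b; c; a; d];
      [:: a; b; c; d; c; b; a; d];
      [:: a; b; c; d; e; d; b; a; c];
      [:: a; b; c; a; b; d; e; d; c];
      [:: a; b; c; b; a; d; e; d; c];
      [:: a; b; c; d; c; a; e; f; e; b]].

(* a_{n-2} a_{n-1} a_{n-3} a_{n-2} ... a_0 a_1 *)
Definition tail_word (T : Type) (a : nat -> T) (n : nat) : seq T :=
  flatten [seq [:: a i; a i.+1] | i <- rev (iota 0 n.-1)].

Definition word_A (T : Type) (x y : T) (a : nat -> T) (n : nat) : seq T :=
  [:: x; a 0; y; a n.-1; x] ++ tail_word a n.

Definition word_B (T : Type) (x y : T) (a : nat -> T) (n : nat) : seq T :=
  [:: a 0; x; y; a n.-1; x; y] ++ tail_word a n.

Definition word_B' (T : Type) (x y : T) (a : nat -> T) (n : nat) : seq T :=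
  [:: a 0; y; x; a n.-1; x; y] ++ tail_word a n.

Definition word_C (T : Type) (x y z : T) (a : nat -> T) (n : nat) : seq T :=
  [:: a 0; x; a n.-1; y; z; y; x] ++ tail_word a n.

Inductive listed : seq nat -> Prop :=
| listed_sporadic w : w \in sporadic -> listed w
| listed_A x y a n : 2 <= n -> uniq [:: x, y & mkseq a n] ->
    listed (word_A x y a n)
| listed_B x y a n : 3 <= n -> uniq [:: x, y & mkseq a n] ->
    listed (word_B x y a n)
| listed_B' x y a n : 3 <= n -> uniq [:: x, y & mkseq a n] ->
    listed (word_B' x y a n)
| listed_C x y z a n : 3 <= n -> uniq [:: x, y, z & mkseq a n] ->
    listed (word_C x y z a n).

(* Main.v *)
Require Import Defs.
From mathcomp Require Import all_boot zify.

(* Say that a color is open while its first sock has been output and its second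
   one has not been read; nothing can be popped meanwhile. When two colors
   cross as b .. c .. b .. c, one of them has to be opened. Reading from left
   to right, a decision is only needed at the second b, with c still on the
   stack: it is best to have opened b just before c was read; if this was
   impossible and c is on top of the stack immediately above b, one opens c
   now; otherwise no schedule exists. There are only three reasons, each
   visible as a short pattern, why b could not be opened before c. Opening b
   may leave completed colors stuck between the remaining ones. A color stuck
   between a_0 and a later color c is what drives the infinite families: when
   c is crossed by d, it becomes stuck between a_0 and d. Recording these
   patterns along the greedy run, every failure exhibits one of the listed
   words as a subsequence.

   Conversely the sporadic words are checked by computation. For the families
   only the constantly many stack configurations after the part preceding the
   tail are computed: in all of them a color is stuck between a_0 and a_{n-1},
   which persists along the tail, and after any deletion one of them can be
   continued. *)

Set Implicit Arguments.
Unset Strict Implicit.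
Unset Printing Implicit Defensive.

(** * Color-sorted outputs and stack configurations *)

Section ColorSorted.
Variable T : eqType.
Implicit Types (s st out : seq T).

Fixpoint sortedb out : bool :=
  if out is x :: r then
    (if r is y :: _ then (x == y) || (x \notin r) else true) && sortedb r
  else true.

(** Avoiding the pattern a b a is inherited by subsequences at a glance, unlike the block form of
    [color_sorted]. *)
Definition aba_free out : Prop := forall a b, subseq [:: a; b; a] out -> a = b.

Lemma subseq_cons_cat_notin a s u v :
  a \notin u -> subseq (a :: s) (u ++ v) -> subseq (a :: s) v.
Proof.
elim: u => //= x u IH; rewrite inE negb_or => /andP[/negPf ax au].
by rewrite ax; apply: IH.
Qed.

Lemma color_sorted_aba out : color_sorted out -> aba_free out.
Proof.
move=> cs a b sub; apply/eqP/negP => /negP ab.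
have [u [v [k [outE au av]]]] := cs a.
have {sub} : subseq [:: b; a] (nseq k a ++ v).
  have := sub; rewrite outE => /(subseq_cons_cat_notin au).
  by apply: subseq_trans; apply: subseq_cons.
move=> sub; have {sub} : subseq [:: b; a] v.
  apply: subseq_cons_cat_notin sub.
  by rewrite mem_nseq (eq_sym b) (negPf ab) andbF.
by move=> /mem_subseq/(_ a); rewrite !inE eqxx orbT (negPf av) => /(_ isT).
Qed.

Lemma aba_sortedb out : aba_free out -> sortedb out.
Proof.
elim: out => //= x r IH aba; apply/andP; split.
  case: r {IH} aba => // y r aba.
  have [//|xy /=] := eqVneq x y; apply/negP; rewrite inE (negPf xy) /= => xr.
  by move/eqP: xy; apply; apply: aba; rewrite /= !eqxx sub1seq.
by apply: IH => a b sub; apply: aba; apply: subseq_trans sub (subseq_cons _ _).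
Qed.

Lemma sortedb_block x r :
  sortedb (x :: r) -> exists k v, r = nseq k x ++ v /\ x \notin v.
Proof.
elim: r x => [|y r IH] x; first by exists 0, [::].
move=> /= /andP[xy yr]; have [eqxy|nxy] := eqVneq x y.
  have [k [v [-> xv]]] := IH _ yr; exists k.+1, v; rewrite -eqxy in xv *.
  by split.
by exists 0, (y :: r); move: xy; rewrite (negPf nxy).
Qed.

Lemma sortedbP out : reflect (color_sorted out) (sortedb out).
Proof.
apply: (iffP idP) => [|/color_sorted_aba/aba_sortedb //].
elim: out => [|x r IH] so c; first by exists [::], [::], 0.
have [->|cx] := eqVneq c x.
  have [k [v [-> xv]]] := sortedb_block so.
  by exists [::], v, k.+1.
have [|u [v [k [-> cu cv]]]] := IH _ c; first by move: so => /= /andP[].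
by exists (x :: u), v, k; split=> //; rewrite inE negb_or cx.
Qed.

Lemma color_sorted_subseq out out' :
  subseq out' out -> color_sorted out -> color_sorted out'.
Proof.
move=> sub /color_sorted_aba aba; apply/sortedbP/aba_sortedb => a b sub'.
exact: aba (subseq_trans sub' sub).
Qed.

(** All pushes and pops of deleted socks are erased from the run. The stack has to shrink as well,
    since a deleted sock is later missing there. *)
Lemma foot_run_subseq s st out s' st' :
  foot_run s st out -> subseq s' s -> subseq st' st ->
  exists2 out', subseq out' out & foot_run s' st' out'.
Proof.
move=> run; elim: run s' st' => {s st out}
  [|x s st out _ IH|x s st out _ IH] s' st'.
- by rewrite !subseq0 => /eqP-> /eqP->; exists [::] => //; constructor.
- case: s' => [|y s'] /=.
    by move=> _ sub; apply: IH (sub0seq _) (subseq_trans sub (subseq_cons _ _)).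
  case: eqP => [->|_] sub sub'.
    have [|out' so run] := IH s' (x :: st') sub; first by rewrite /= eqxx.
    by exists out' => //; constructor.
  exact: IH sub (subseq_trans sub' (subseq_cons _ _)).
- case: st' => [|y st'] /= sub.
    move=> _; have [out' so run] := IH s' [::] sub (sub0seq _).
    by exists out' => //; apply: subseq_trans so (subseq_cons _ _).
  case: eqP => [->|_] sub'.
    have [out' so run] := IH s' st' sub sub'.
    by exists (x :: out'); [rewrite /= eqxx | constructor].
  have [out' so run] := IH s' (y :: st') sub sub'.
  by exists out' => //; apply: subseq_trans so (subseq_cons _ _).
Qed.

Lemma foot_sortable_subseq s s' :
  subseq s' s -> foot_sortable s -> foot_sortable s'.
Proof.
move=> sub [out run cs].
have [out' so run'] := foot_run_subseq run sub (sub0seq [::]).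
by exists out' => //; apply: color_sorted_subseq so cs.
Qed.

Lemma subseq_proper_split s s' : subseq s' s -> s' != s ->
  exists u x v, s = u ++ x :: v /\ subseq s' (u ++ v).
Proof.
elim: s s' => [|x s IH] s'; first by rewrite subseq0 => ->.
case: s' => [|y s'] /=; first by exists [::], x, s; rewrite sub0seq.
case: eqP => [-> sub ne|_ sub _]; last by exists [::], x, s.
have [|u [z [v [-> sub']]]] := IH _ sub; first by apply: contraNneq ne => ->.
by exists (x :: u), z, v; rewrite /= eqxx.
Qed.

Lemma minimal_subseq s s' : minimal_non_foot_sortable s ->
  subseq s' s -> ~ foot_sortable s' -> s' = s.
Proof.
move=> [_ min] sub ns; apply/eqP/negP => /negP ne.
have [u [x [v [sE sub']]]] := subseq_proper_split sub ne.
exact: ns (foot_sortable_subseq sub' (min _ _ _ sE)).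
Qed.

(** * Enumeration of runs by their configurations *)

Fixpoint pops (st out : seq T) : seq (seq T * seq T) :=
  (st, out) :: if st is x :: st' then pops st' (rcons out x) else [::].

Definition push_all (x : T) (c : seq T * seq T) : seq (seq T * seq T) :=
  [seq (x :: d.1, d.2) | d <- pops c.1 c.2].

(* The configurations (stack, output) just after the last sock of [s] has been
   pushed, for all choices of the pops before it. *)
Definition configs s : seq (seq T * seq T) :=
  foldl (fun cs x => flatten [seq push_all x c | c <- cs]) [:: ([::], [::])] s.

Lemma configs_rcons s x :
  configs (rcons s x) = flatten [seq push_all x c | c <- configs s].
Proof. by rewrite /configs -cats1 foldl_cat. Qed.

Lemma popsP st out c :
  reflect (exists st1, st = st1 ++ c.1 /\ c.2 = out ++ st1) (c \in pops st out).
Proof.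
apply: (iffP idP).
  elim: st out => [|x st IH] out /=; rewrite inE.
    by move/eqP->; exists [::]; rewrite cats0.
  case/orP=> [/eqP->|/IH[st1 [stE cE]]]; first by exists [::]; rewrite cats0.
  by exists (x :: st1); rewrite stE cE cat_rcons.
case: c => st2 out2 /= [st1 [-> ->]] {st out2}.
elim: st1 out => [|x st1 IH] out /=.
  by rewrite cats0; case: st2 => *; rewrite inE eqxx.
by rewrite inE -cat_rcons IH orbT.
Qed.

Lemma foot_run_pop_all st : foot_run [::] st st.
Proof. by elim: st => [|x st IH]; constructor. Qed.

Lemma foot_run_pops s st1 st out :
  foot_run s st out -> foot_run s (st1 ++ st) (st1 ++ out).
Proof. by move=> run; elim: st1 => //= x st1; constructor. Qed.

Lemma foot_run_nil st out : foot_run [::] st out -> out = st.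
Proof.
suff gen s : foot_run s st out -> s = [::] -> out = st by move/gen; apply.
by elim=> // x s' st' out' _ IH /IH->.
Qed.

Lemma foot_run_cons x s st out : foot_run (x :: s) st out ->
  exists st1 st2 out2,
    [/\ st = st1 ++ st2, out = st1 ++ out2 & foot_run s (x :: st2) out2].
Proof.
move sE: (x :: s) => s' run.
elim: run sE => // {s' st out} [y s' st out run _|y s' st out run IH].
  by case=> -> ->; exists [::], st, out.
by move=> /IH [st1 [st2 [out2 [-> -> run']]]]; exists (y :: st1), st2, out2.
Qed.

(** The run is cut right after the last push of [p], so that all later pops belong to the part
    reading [q]. *)
Lemma foot_run_configs p q out : foot_run (p ++ q) [::] out <->
  exists2 c, c \in configs p &
  exists2 out2, foot_run q c.1 out2 & out = c.2 ++ out2.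
Proof.
move: p q out; apply: last_ind => [|p x IH] q out.
  split=> [run|[c]]; first by exists ([::], [::]); [|exists out].
  by rewrite inE => /eqP-> [out2 run ->].
rewrite cat_rcons IH configs_rcons; split=> [[[st out1] cp [out2 /=]]|].
  move=> /foot_run_cons[st1 [st2 [out3 [stE out2E run]]]] ->.
  exists (x :: st2, out1 ++ st1); last by exists out3; rewrite ?out2E ?catA.
  apply/flatten_mapP; exists (st, out1) => //; apply/mapP.
  by exists (st2, out1 ++ st1) => //; apply/popsP; exists st1.
move=> [c /flatten_mapP[[st out1] cp /mapP[[st2 out2]]]].
move=> /popsP[st1 [/= stE ->]] -> [out3 /= run ->] {out}; rewrite stE in cp.
exists (st1 ++ st2, out1) => //; exists (st1 ++ out3); last by rewrite catA.
by apply: foot_run_pops; constructor.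
Qed.

(** After the last push the only completion is to pop everything, hence one output per
    configuration. *)
Definition sortableb s : bool :=
  has (fun c => sortedb (c.2 ++ c.1)) (configs s).

Lemma sortableP s : reflect (foot_sortable s) (sortableb s).
Proof.
apply: (iffP hasP) => [[c cs /sortedbP so]|[out run /sortedbP so]].
  exists (c.2 ++ c.1) => //; rewrite -[s]cats0; apply/foot_run_configs.
  by exists c => //; exists c.1 => //; apply: foot_run_pop_all.
rewrite -[s]cats0 in run.
have /foot_run_configs[c cs [out2 /foot_run_nil-> outE]] := run.
by exists c; rewrite -?outE.
Qed.

Lemma foot_run_perm s st out : foot_run s st out -> perm_eq out (s ++ st).
Proof.
elim=> {s st out} [|x s st out _ IH|x s st out _ IH] //.
  by apply: perm_trans IH _; rewrite perm_catC /= perm_cons perm_catC.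
by rewrite perm_sym perm_catC /= perm_cons perm_catC perm_sym.
Qed.

Lemma foot_run_stack_subseq s st out : foot_run s st out -> subseq st out.
Proof.
elim=> {s st out} [|x s st out _ IH|x s st out _ IH] //=; last by rewrite eqxx.
exact: subseq_trans (subseq_cons _ _) IH.
Qed.

End ColorSorted.

(** * Invariance under renaming of the colors *)

Lemma foot_run_map (T U : eqType) (f : T -> U) s st out :
  foot_run s st out -> foot_run (map f s) (map f st) (map f out).
Proof. by elim=> *; constructor. Qed.

Lemma foot_sortable_map (T U : eqType) (f : T -> U) s :
  {in s &, injective f} -> foot_sortable s -> foot_sortable (map f s).
Proof.
move=> f_inj [out run cs]; exists (map f out); first exact: foot_run_map run.
have outs : out =i s by move=> x; rewrite (perm_mem (foot_run_perm run)) cats0.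
move=> c; have [/mapP[d dout ->]|cout] := boolP (c \in map f out); last first.
  by exists (map f out), [::], 0; split; rewrite //= cats0.
have [u [v [k [outE du dv]]]] := cs d.
have notin w : {subset w <= out} -> d \notin w -> f d \notin map f w.
  move=> sub; apply: contra => /mapP[e ew dE].
  by rewrite (f_inj _ _ _ _ dE) // -outs //; apply: sub.
exists (map f u), (map f v), k; split.
- by rewrite outE !map_cat map_nseq.
- by apply: notin du => x xu; rewrite outE mem_cat xu.
- by apply: notin dv => x xv; rewrite outE !mem_cat xv !orbT.
Qed.

Lemma renaming_inv (T U : eqType) (f : T -> U) (x0 : T) w :
  {in w &, injective f} -> exists2 g : U -> T,
  map g (map f w) = w & {in map f w &, injective g}.
Proof.
move=> f_inj; pose g c := nth x0 w (index c (map f w)).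
have gK x : x \in w -> g (f x) = x.
  move=> xw; rewrite /g; elim: w xw f_inj {g} => //= y w IH.
  rewrite inE => /predU1P[<- _|xw f_inj]; first by rewrite eqxx.
  case: eqP => [fyx|_ /=].
    by apply: f_inj; rewrite ?inE ?eqxx ?xw ?orbT.
  by apply: IH => // u v uw vw; apply: f_inj; rewrite inE ?uw ?vw orbT.
exists g; first by rewrite -map_comp map_id_in.
by move=> _ _ /mapP[x xw ->] /mapP[y yw ->]; rewrite !gK // => ->.
Qed.

Lemma renaming_foot_sortable (T U : eqType) (w : seq T) (s : seq U) :
  renaming w s -> foot_sortable w <-> foot_sortable s.
Proof.
case: w => [[f _ -> /=]|x0 w [f f_inj ->]].
  by split=> _; exists [::] => //; try constructor; apply/sortedbP.
split; first exact: foot_sortable_map.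
have [g gE g_inj] := renaming_inv x0 f_inj.
by move=> /(foot_sortable_map g_inj); rewrite gE.
Qed.

Lemma renaming_minimal (T U : eqType) (w : seq T) (s : seq U) :
  renaming w s -> minimal_non_foot_sortable w -> minimal_non_foot_sortable s.
Proof.
move=> ren [ns min]; split; first by move/(renaming_foot_sortable ren).
case: ren => f f_inj sE u v x usE.
have uE : u = map f (take (size u) w) by rewrite map_take -sE usE take_size_cat.
have vE : v = map f (drop (size u).+1 w).
  by rewrite map_drop -sE usE -cat_rcons drop_size_cat ?size_rcons.
have ltuw : size u < size w.
  by rewrite -(size_map f) -sE usE size_cat /= addnS ltnS leq_addr.
have x0 : T by case: (w) ltuw.
have /min : w = take (size u) w ++ nth x0 w (size u) :: drop (size u).+1 w.
  by rewrite -drop_nth // cat_take_drop.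
move/(@foot_sortable_map _ _ f); rewrite map_cat -uE -vE; apply.
move=> a b aw bw; apply: f_inj.
  by move: aw; rewrite mem_cat => /orP[/mem_take|/mem_drop].
by move: bw; rewrite mem_cat => /orP[/mem_take|/mem_drop].
Qed.

Lemma renaming_two_bounded (T U : eqType) (w : seq T) (s : seq U) :
  renaming w s -> two_bounded w -> two_bounded s.
Proof.
move=> [f f_inj ->] tb c.
have [/mapP[d dw ->]|/count_memPn-> //] := boolP (c \in map f w).
rewrite count_map; apply: leq_trans (tb d); rewrite leq_eqVlt; apply/orP; left.
by apply/eqP/eq_in_count => x xw /=; rewrite (inj_in_eq f_inj).
Qed.

(** * Schedules with at most one open color *)

Section Positions.
Variables (T : eqType) (s : seq T) (x0 : T).

(** For a color that does not occur, [fst_pos] is [size s] and [lst_pos] is 0; for a color occurring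
    once they agree. Inequalities between positions thus also encode membership and multiplicity. *)
Definition fst_pos (c : T) := index c s.
Definition lst_pos (c : T) := (size s).-1 - index c (rev s).
Local Notation F := fst_pos.
Local Notation L := lst_pos.

(* [nth] with a default is harmless here: the positions are below [t], and [t]
   is at most [size s] in all uses. *)
Definition occurs (w : seq T) (t : nat) :=
  exists P, [/\ sorted ltn P, all (gtn t) P & w = [seq nth x0 s i | i <- P]].

Lemma occurs_subseq w t : t <= size s -> occurs w t -> subseq w s.
Proof.
move=> ts [P [srt Pt ->]]; apply: (@subseq_trans _ (take t s)); last first.
  by rewrite -{2}(cat_take_drop t s) prefix_subseq.
rewrite -(map_nth_iota0 x0 ts); apply: map_subseq.
(* A strictly increasing list is determined by its members. *)
have -> : P = [seq i <- iota 0 t | i \in P]; last exact: filter_subseq.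
apply: (irr_sorted_eq ltn_trans ltnn srt).
  exact/(sorted_filter ltn_trans)/iota_ltn_sorted.
move=> i; rewrite mem_filter mem_iota /=; case iP: (i \in P) => //=.
by rewrite add0n; apply/esym/(allP Pt).
Qed.

Lemma occurs_leq w t t' : t <= t' -> occurs w t -> occurs w t'.
Proof.
move=> tt' [P [srt Pt ->]]; exists P; split=> //.
by apply/allP => i /(allP Pt) /= it; apply: leq_trans it tt'.
Qed.

Lemma occurs_cat w t i j : occurs w t -> t <= i < j ->
  occurs (w ++ [:: nth x0 s i; nth x0 s j]) j.+1.
Proof.
move=> [P [srt Pt ->]] /andP[ti ij]; exists (P ++ [:: i; j]); split.
- move: srt; rewrite !(sorted_pairwise ltn_trans) pairwise_cat /= ij => ->.
  rewrite !andbT; apply/allrelP => a b /(allP Pt) /= at_; rewrite !inE.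
  by case/orP => /eqP->; lia.
- rewrite all_cat /= ltnS ltnSn (ltnW ij) !andbT.
  by apply/allP => a /(allP Pt) /=; lia.
- by rewrite map_cat.
Qed.

Lemma fst_pos_size c : (F c < size s) = (c \in s).
Proof. exact: index_mem. Qed.

Lemma nth_fst c : c \in s -> nth x0 s (F c) = c.
Proof. exact: nth_index. Qed.

Lemma nth_lst c : c \in s -> nth x0 s (L c) = c.
Proof.
rewrite -mem_rev => cs; have := cs; rewrite -index_mem size_rev => lt.
rewrite -[RHS](nth_index x0 cs) nth_rev //; congr nth; rewrite /lst_pos; lia.
Qed.

Lemma lst_pos_size c : c \in s -> L c < size s.
Proof. by rewrite -fst_pos_size /lst_pos; lia. Qed.

Lemma fst_pos_min i : i < size s -> F (nth x0 s i) <= i.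
Proof.
exact: index_nth.
Qed.

Lemma lst_pos_max i : i < size s -> i <= L (nth x0 s i).
Proof.
move=> lti; have : index (nth x0 s i) (rev s) <= (size s).-1 - i.
  rewrite leqNgt; apply/negP => lt; have /= := before_find x0 lt.
  rewrite nth_rev; last by lia.
  have -> : size s - ((size s).-1 - i).+1 = i by lia.
  by rewrite eqxx.
rewrite /lst_pos; lia.
Qed.

Lemma fst_pos_inj c d : F c < size s -> F c = F d -> c = d.
Proof.
move=> cs e; rewrite -(@nth_fst c) -?fst_pos_size // e nth_fst //.
by rewrite -fst_pos_size -e.
Qed.

Lemma two_bounded_pos i : two_bounded s -> i < size s ->
  i = F (nth x0 s i) \/ i = L (nth x0 s i).
Proof.
move=> tb lti; have := fst_pos_min lti; have := lst_pos_max lti.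
set y := nth x0 s i; have ys : y \in s by apply: mem_nth.
have := lst_pos_size ys.
have [->|ne] := eqVneq i (F y); first by left.
have [->|ne'] := eqVneq i (L y); first by right.
move=> Ls le1 le2; have sub : subseq [:: y; y; y] s.
  apply: (@occurs_subseq _ (size s)) => //.
  exists [:: F y; i; L y]; split=> /=; try lia.
  by rewrite nth_fst // nth_lst.
by have := leq_count_subseq (pred1 y) sub; have := tb y; rewrite /= eqxx; lia.
Qed.

(** The latest newcomer comes first: this is the order of the colors on a stack, top first, as long
    as equal colors stay together. *)
Fixpoint firsts t : seq T :=
  if t is t'.+1 then
    let y := nth x0 s t' in if F y == t' then y :: firsts t' else firsts t'
  else [::].

Lemma mem_firsts t x : t <= size s -> (x \in firsts t) = (F x < t).
Proof.
elim: t => //= t IH lt; have lt' := ltnW lt.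
have [e|ne] := eqVneq (F x) t.
  have -> : nth x0 s t = x by rewrite -e nth_fst // -fst_pos_size e.
  by rewrite e eqxx inE eqxx ltnSn.
rewrite ltnS leq_eqVlt (negPf ne) -IH //; case: eqP => // e.
by rewrite inE; case: eqP => // xE; rewrite xE e eqxx in ne.
Qed.

Lemma firsts_sorted t : t <= size s ->
  pairwise (fun c d => F d < F c) (firsts t).
Proof.
elim: t => //= t IH lt; have lt' := ltnW lt; case: eqP => e /=; rewrite IH //.
by rewrite andbT; apply/allP => d /=; rewrite mem_firsts // e.
Qed.

Definition stk t (A : pred T) := [seq x <- firsts t | A x].
Definition cnt t x := count_mem x (take t s).
Definition blocks t l := flatten [seq nseq (cnt t x) x | x <- l].

Lemma mem_stk t A x : t <= size s -> (x \in stk t A) = A x && (F x < t).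
Proof. by move=> ts; rewrite mem_filter mem_firsts. Qed.

Lemma stk_sorted t A : t <= size s ->
  pairwise (fun c d => F d < F c) (stk t A).
Proof.
by move=> ts; apply: subseq_pairwise (filter_subseq _ _) (firsts_sorted ts).
Qed.

Lemma stk_top t (A : pred T) y : t <= size s -> A y -> F y < t ->
  (forall d, A d -> F d < t -> F d <= F y) ->
  stk t A = y :: stk t (fun x => A x && (x != y)).
Proof.
move=> ts Ay yt top; have : y \in stk t A by rewrite mem_stk // Ay.
have := stk_sorted A ts; have memE := mem_stk A _ ts.
have -> : stk t (fun x => A x && (x != y)) = [seq x <- stk t A | x != y].
  by rewrite /stk -filter_predI; apply: eq_filter => x /=; rewrite andbC.
case: (stk t A) memE => // z r memE /= /andP[zr _].
have /andP[Az zt] : A z && (F z < t) by rewrite -memE inE eqxx.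
have <- : z = y.
  apply: fst_pos_inj; first lia.
  have := top _ Az zt; have : y \in z :: r by rewrite memE Ay.
  rewrite inE => /predU1P[-> //|/(allP zr)]; lia.
move=> _; rewrite eqxx /=; congr (_ :: _); apply/esym/all_filterP/allP => d.
by move/(allP zr); apply: contraTneq => ->; rewrite ltnn.
Qed.

Lemma cntS t x : t < size s -> cnt t.+1 x = cnt t x + (nth x0 s t == x).
Proof.
by move=> lt; rewrite /cnt (take_nth x0) // -cats1 count_cat /= addn0.
Qed.

Lemma cnt_new t x : t <= F x -> cnt t x = 0.
Proof.
move=> tF; apply/count_memPn.
have ts : t <= size s by apply: leq_trans tF (index_size _ _).
by rewrite in_take_leq // -leqNgt.
Qed.

Lemma cnt_done t x : t < size s -> x \in s -> L x < t -> cnt t.+1 x = cnt t x.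
Proof.
move=> lt xs Lx; rewrite cntS //; case: eqP => [e|]; last by rewrite addn0.
by have := lst_pos_max lt; rewrite e; lia.
Qed.

Lemma blocks_cat t l1 l2 : blocks t (l1 ++ l2) = blocks t l1 ++ blocks t l2.
Proof. by rewrite /blocks map_cat flatten_cat. Qed.

Lemma eq_blocks t t' l : (forall x, x \in l -> cnt t x = cnt t' x) ->
  blocks t l = blocks t' l.
Proof. by move=> e; congr flatten; apply/eq_in_map => x /e->. Qed.

(* [reach t A o]: some schedule that reads the first [t] socks leaves on the
   stack exactly the colors [x] with [A x] that have been read, ordered by first
   occurrence; [A] also holds for colors not read yet. If [o] is [Some y], then
   the last color output is [y] and nothing may be popped until the next [y]. *)
Definition reach t (A : pred T) (o : option T) : Prop :=
  exists2 done : seq T,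
  [/\ uniq (done ++ seq_of_opt o),
      {in done ++ seq_of_opt o, forall x, (F x < t) && ~~ A x} &
      {in done, forall x, L x < t}] &
  forall q out, foot_run q (blocks t (stk t A)) out ->
    foot_run (take t s ++ q) [::] (blocks t (done ++ seq_of_opt o) ++ out).

Lemma reach_start A : reach 0 A None.
Proof. by exists [::] => // q out; rewrite take0. Qed.

Lemma reach_ext t (A B : pred T) o : t <= size s ->
  (forall x, F x < t -> A x = B x) -> reach t A o -> reach t B o.
Proof.
move=> ts AB [done [ud dA dL] run]; exists done.
  by split=> // x xd; have /andP[xt] := dA _ xd; rewrite AB ?xt.
suff <- : stk t A = stk t B by [].
by apply: eq_in_filter => x; rewrite mem_firsts // => /AB.
Qed.

Lemma take_cat_nth t q : t < size s ->
  take t.+1 s ++ q = take t s ++ nth x0 s t :: q.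
Proof. by move=> lt; rewrite (take_nth x0) // cat_rcons. Qed.

Lemma blocks_done t l : t < size s -> {in l, forall x, F x < t} ->
  {in l, forall x, L x < t} -> blocks t.+1 l = blocks t l.
Proof.
move=> lt lF lL; apply: eq_blocks => x xl.
apply: cnt_done => //; last exact: lL.
by rewrite -fst_pos_size (ltn_trans (lF _ xl)).
Qed.

(** A new color lands on top, and an old one is pushed only when its block is already on top. So the
    stack remains a sequence of blocks ordered by first occurrence. *)
Lemma reach_push t (A : pred T) o : t < size s -> let y := nth x0 s t in
  A y -> (F y < t -> forall d, A d -> F d < t -> F d <= F y) ->
  reach t A o -> reach t.+1 A o.
Proof.
move=> lt y Ay top [done [ud dA dL] run]; have ts := ltnW lt.
have cntE x : x != y -> cnt t.+1 x = cnt t x.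
  by move=> xy; rewrite cntS // -/y (eq_sym y) (negPf xy) addn0.
have notin l : {in l, forall x, ~~ A x} -> {in l, forall x, x != y}.
  by move=> lA x /lA; apply: contraNneq => ->.
exists done; first by split=> // x xd;
  [have /andP[xt ->] := dA _ xd; rewrite ltnS ltnW | apply/ltnW/dL].
have -> : blocks t.+1 (done ++ seq_of_opt o) = blocks t (done ++ seq_of_opt o).
  apply: eq_blocks => x xd; apply: cntE; apply: notin xd => z /dA.
  by case/andP.
suff stkE : blocks t.+1 (stk t.+1 A) = y :: blocks t (stk t A).
  move=> q out runq; rewrite take_cat_nth //; apply: run.
  by constructor; rewrite -/y -stkE.
have yF := fst_pos_min lt; rewrite -/y in yF.
rewrite /stk /= -/y; have [Fy|Fy] := eqVneq (F y) t.
  rewrite /= Ay /blocks /= cntS // cnt_new ?Fy // -/y eqxx /=; congr (_ :: _).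
  apply: eq_blocks => x; rewrite mem_filter mem_firsts // => /andP[_ xt].
  by apply: cntE; apply: contraTneq xt => ->; rewrite Fy ltnn.
have Fyt : F y < t by rewrite ltn_neqAle Fy.
have -> : [seq x <- firsts t | A x] = stk t A by [].
rewrite (stk_top ts Ay Fyt (top Fyt)) /blocks /= cntS // -/y eqxx addn1 /=.
congr (_ :: _ ++ _); apply: eq_blocks => x; rewrite mem_stk //.
by case/andP=> /andP[_ xy] _; apply: cntE.
Qed.

(** The sock is pushed and popped at once, joining its color at the end of the output. *)
Lemma reach_close t (A : pred T) : t < size s -> let y := nth x0 s t in
  L y = t -> reach t A (Some y) -> reach t.+1 A None.
Proof.
move=> lt y Ly [done [ud dA dL] run]; have ts := ltnW lt.
have /andP[yt nAy] : (F y < t) && ~~ A y.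
  by apply: dA; rewrite mem_cat inE eqxx orbT.
have ydone : y \notin done.
  by move: ud; rewrite cats1 rcons_uniq => /andP[].
exists (rcons done y).
  rewrite cats0; split; first by rewrite -cats1.
  - by move=> x; rewrite -cats1 => /dA/andP[xt ->]; rewrite ltnS ltnW.
  - by move=> x; rewrite mem_rcons inE => /predU1P[->|/dL/ltnW //]; rewrite Ly.
move=> q out runq; rewrite take_cat_nth // -/y cats0 -cats1 blocks_cat -catA.
rewrite blocks_done //; first last.
  move=> x xd; suff /dA/andP[] : x \in done ++ seq_of_opt (Some y) by [].
  by rewrite mem_cat xd.
have stkE : blocks t.+1 (stk t.+1 A) = blocks t (stk t A).
  rewrite /stk /= -/y (ltn_eqF yt); apply: eq_blocks => x.
  rewrite mem_filter => /andP[Ax _]; rewrite cntS // -/y.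
  by case: eqP => [yx|_]; [rewrite yx Ax in nAy | rewrite addn0].
have /run : foot_run (y :: q) (blocks t (stk t A)) (y :: out).
  by do 2!constructor; rewrite -stkE.
rewrite blocks_cat -catA; congr foot_run; congr (_ ++ _).
by rewrite /blocks /= cntS // -/y eqxx !cats0 nseqD -catA.
Qed.

Lemma reach_take_top t (A : pred T) y o :
  t <= size s -> A y -> F y < t -> (forall d, A d -> F d < t -> F d <= F y) ->
  (if o is Some z then z = y else L y < t) ->
  reach t A None -> reach t (fun x => A x && (x != y)) o.
Proof.
move=> ts Ay yt top oy [done [ud dA dL] run].
rewrite cats0 in ud dA.
have ydone : y \notin done.
  by apply: contraL Ay => /dA/andP[].
pose B : pred T := fun x => A x && (x != y).
have runy q out : foot_run q (blocks t (stk t B)) out ->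
    foot_run (take t s ++ q) [::] (blocks t (rcons done y) ++ out).
  move=> runq; rewrite -cats1 blocks_cat -catA; rewrite cats0 in run.
  apply: run; rewrite (stk_top ts Ay yt top) -cat1s !blocks_cat.
  exact: foot_run_pops.
have dA' : {in rcons done y, forall x, (F x < t) && ~~ (A x && (x != y))}.
  move=> x; rewrite mem_rcons inE => /predU1P[->|/dA/andP[-> /negPf-> //]].
  by rewrite yt eqxx andbF.
case: o oy => [_ ->|yL].
  by exists done; [split; rewrite ?cats1 ?rcons_uniq ?ydone|rewrite cats1].
exists (rcons done y); last by rewrite cats0.
split; rewrite ?cats0 ?rcons_uniq ?ydone // => x.
by rewrite mem_rcons inE => /predU1P[->|/dL].
Qed.

Lemma reach_sortable A : (forall x, F x < size s -> ~~ A x) ->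
  reach (size s) A None -> foot_sortable s.
Proof.
move=> nA [done [ud dA dL] run]; rewrite cats0 in ud dA run.
have stk0 : stk (size s) A = [::].
  apply/nilP; rewrite /nilp -all_pred0; apply/allP => x.
  by rewrite mem_stk // => /andP[Ax /nA]; rewrite Ax.
exists (blocks (size s) done).
  have := run [::] [::]; rewrite stk0 take_size !cats0; apply.
  exact: foot_done.
move=> c; have [cd|cd] := boolP (c \in done); last first.
  exists (blocks (size s) done), [::], 0; split; rewrite //= ?cats0 //.
  apply: contra cd => /flattenP[_ /mapP[x xd ->]].
  by rewrite mem_nseq => /andP[_ /eqP->].
have notin l : c \notin l -> c \notin blocks (size s) l.
  apply: contra => /flattenP[_ /mapP[x xd ->]].
  by rewrite mem_nseq => /andP[_ /eqP->].
case/splitPr: cd ud => l1 l2; rewrite cat_uniq /= negb_or.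
case/and4P=> _ /andP[c1 _] c2 _.
exists (blocks (size s) l1), (blocks (size s) l2), (cnt (size s) c).
by split; rewrite ?notin // -cat1s !blocks_cat /blocks /= cats0.
Qed.

End Positions.

(** * The listed words *)

Section ZigZag.
Variable T : Type.
Implicit Types (a b c x y z : T) (l xs H : seq T).

(** A new first letter of the list appends two letters at the end of the word, which is how a
    pattern grows while socks are read. *)
Fixpoint zigzag l : seq T :=
  if l is a :: l' then
    if l' is b :: _ then zigzag l' ++ [:: a; b] else [::]
  else [::].

Lemma zigzag_cons2 a b l : zigzag [:: a, b & l] = zigzag (b :: l) ++ [:: a; b].
Proof. by []. Qed.

Lemma tail_word_zigzag (a : nat -> T) n : tail_word a n = zigzag (mkseq a n).
Proof.
elim: n a => [|[|n] IH] a //.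
have mkseqS (g : nat -> T) m : mkseq g m.+1 = g 0 :: mkseq (g \o S) m.
  by rewrite /mkseq map_comp -(iotaDl 1 0).
rewrite mkseqS mkseqS zigzag_cons2 -mkseqS -IH /tail_word.
rewrite -[n.+2.-1]/(n.+1) -[n.+1.-1]/n /= (iotaDl 1 0).
by rewrite rev_cons map_rcons flatten_rcons -map_rev -map_comp.
Qed.

(* The word preceding the tail in the four families, with [b] for [a_0], [c]
   for [a_{n-1}], and [xs] listing the other letters. *)
Inductive prelude b c : seq T -> seq T -> Prop :=
| prelude_A x y : prelude b c [:: x; y] [:: x; b; y; c; x]
| prelude_B x y : prelude b c [:: x; y] [:: b; x; y; c; x; y]
| prelude_B' x y : prelude b c [:: x; y] [:: b; y; x; c; x; y]
| prelude_C x y z : prelude b c [:: x; y; z] [:: b; x; c; y; z; y; x].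

End ZigZag.

Lemma map_zigzag T U (f : T -> U) l : map f (zigzag l) = zigzag (map f l).
Proof.
by elim: l => [|a [|b l] IH] //; rewrite zigzag_cons2 map_cat IH.
Qed.

Lemma mem_zigzag (T : eqType) (l : seq T) : {subset zigzag l <= l}.
Proof.
elim: l => [|a [|b l] IH] // x; rewrite zigzag_cons2 mem_cat => /orP[/IH|].
  by move=> xl; rewrite inE xl orbT.
by rewrite !inE => /orP[]->; rewrite ?orbT.
Qed.

Section BadWords.
Variables (T : eqType) (x0 : T).
Implicit Types (b c x y z : T) (l xs H : seq T).

Definition bad_word (v : seq T) : Prop :=
  exists2 w : seq nat, listed w & renaming w v.

Lemma renaming_nth (ls : seq T) w : uniq ls -> all (gtn (size ls)) w ->
  renaming w (map (nth x0 ls) w).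
Proof.
move=> uls /allP wls; exists (nth x0 ls) => // i j /wls /= iw /wls /= jw.
by move/eqP; rewrite nth_uniq // => /eqP.
Qed.

Lemma bad_sporadic (pat : seq nat) (ls : seq T) : pat \in sporadic ->
  uniq ls -> all (gtn (size ls)) pat -> bad_word (map (nth x0 ls) pat).
Proof.
move=> sp uls pls; exists pat; first exact: listed_sporadic.
exact: renaming_nth.
Qed.

Lemma bad_family b c cs xs H : prelude b (last c cs) xs H ->
  uniq (xs ++ [:: b, c & cs]) -> bad_word (H ++ zigzag [:: b, c & cs]).
Proof.
(* For [n = 2] only (A) is a listed family; the words of (B), (B') and (C) are then three of the
   sporadic ones. *)
case: cs => [|c' cs].
  case=> [x y|x y|x y|x y z] /= u.
  - exists (word_A 0 1 (addn 2) 2); first exact: listed_A.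
    exact: (@renaming_nth [:: x; y; b; c]).
  - apply: (@bad_sporadic [:: 0; 1; 2; 3; 1; 2; 0; 3] [:: b; x; y; c]) => //.
    rewrite -(perm_uniq (s1 := [:: x; y; b; c])) //.
    by apply/permP => p /=; lia.
  - apply: (@bad_sporadic [:: 0; 1; 2; 3; 2; 1; 0; 3] [:: b; y; x; c]) => //.
    rewrite -(perm_uniq (s1 := [:: x; y; b; c])) //.
    by apply/permP => p /=; lia.
  - apply: (@bad_sporadic [:: 0; 1; 2; 3; 4; 3; 1; 0; 2]
              [:: b; x; c; y; z]) => //.
    rewrite -(perm_uniq (s1 := [:: x; y; z; b; c])) //.
    by apply/permP => p /=; lia.
set l := [:: b, c, c' & cs] => pre u; pose n := size l.
(* [f] decodes the numbering in which the letters of [xs] come first and [a_i] has number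
   [size xs + i]. *)
have [f fE] : exists f, f = nth x0 (xs ++ l) by eexists.
have ren w : all (gtn (size (xs ++ l))) w -> renaming w (map f w).
  by move=> wlt; rewrite fE; apply: renaming_nth.
have fxs i : i < size xs -> f i = nth x0 xs i.
  by move=> lti; rewrite fE nth_cat lti.
have fb : f (size xs + 0) = b by rewrite fE nth_cat addn0 ltnn subnn.
have fc : f (size xs + n.-1) = last c (c' :: cs).
  rewrite fE nth_cat ltnNge leq_addr /= addKn /n /= (last_nth x0).
  by [].
have tE : H ++ zigzag l = H ++ map f (tail_word (addn (size xs)) n).
  rewrite tail_word_zigzag map_zigzag; congr (_ ++ zigzag _).
  rewrite /mkseq -iotaDl addn0 fE map_nth_iota; last by rewrite size_cat; lia.
  by rewrite drop_size_cat // take_size.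
have tlt : all (gtn (size xs + n)) (tail_word (addn (size xs)) n).
  apply/allP => i; rewrite tail_word_zigzag => /mem_zigzag/mapP[j].
  by rewrite mem_iota /= => ? ->; lia.
rewrite size_cat -/n in ren.
have unat m : uniq (iota 0 m ++ mkseq (addn m) n).
  by rewrite /mkseq -iotaDl addn0 -iotaD iota_uniq.
have n3 : 3 <= n by [].
rewrite {}tE; clear fE u; move: n3 fc tlt; rewrite -/n.
clearbody n; clear l.
case: pre ren fxs fb => [x y|x y|x y|x y z] /= ren fxs fb n3 fc tlt.
- exists (word_A 0 1 (addn 2) n).
    by apply: listed_A; [lia | apply: (unat 2)].
  have := ren (word_A 0 1 (addn 2) n); rewrite map_cat /= fb fc !fxs //=.
  by apply; rewrite tlt !andbT; lia.
- exists (word_B 0 1 (addn 2) n).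
    by apply: listed_B => //; apply: (unat 2).
  have := ren (word_B 0 1 (addn 2) n); rewrite map_cat /= fb fc !fxs //=.
  by apply; rewrite tlt !andbT; lia.
- exists (word_B' 0 1 (addn 2) n).
    by apply: listed_B' => //; apply: (unat 2).
  have := ren (word_B' 0 1 (addn 2) n); rewrite map_cat /= fb fc !fxs //=.
  by apply; rewrite tlt !andbT; lia.
- exists (word_C 0 1 2 (addn 3) n).
    by apply: listed_C => //; apply: (unat 3).
  have := ren (word_C 0 1 2 (addn 3) n); rewrite map_cat /= fb fc !fxs //=.
  by apply; rewrite tlt !andbT; lia.
Qed.

End BadWords.

(** * Forced patterns *)

Section Patterns.
Variables (T : eqType) (s : seq T) (x0 : T).
Local Notation F := (fst_pos s).
Local Notation L := (lst_pos s).
Local Notation occurs := (occurs s x0).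

Definition bad : Prop := exists2 v, bad_word v & occurs v (size s).

(* A beginning of a listed word with [a_0 = b] and [a_{n-1}, ...] ending in the
   still incomplete [c]; it forces a completed color to lie between [b] and [c]
   on the stack, unless [c] is open. *)
Definition chain b c t : Prop := exists xs H cs,
  [/\ prelude b (last c cs) xs H, uniq (xs ++ [:: b, c & cs]) &
      occurs (H ++ zigzag (c :: cs)) t].

Lemma chain_leq b c t t' : t <= t' -> chain b c t -> chain b c t'.
Proof.
move=> tt' [xs [H [cs [pre u occ]]]]; exists xs, H, cs; split=> //.
exact: occurs_leq occ.
Qed.

Lemma mem_occurs w t x : t <= size s -> occurs w t -> x \in w -> F x < t.
Proof.
move=> ts [P [_ /allP Pt ->]] /mapP[i /Pt /= it ->].
by apply: leq_ltn_trans (it); apply: fst_pos_min; apply: leq_trans it ts.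
Qed.

(** The last letter is missing from the word only for a one-letter list; the prelude supplies it. *)
Lemma mem_last_zigzag (c : T) cs :
  {subset c :: cs <= last c cs :: zigzag (c :: cs)}.
Proof.
elim: cs c => [|d cs IH] c x //.
rewrite zigzag_cons2 inE => /predU1P[->|/IH]; rewrite !inE mem_cat.
  by rewrite !inE eqxx !orbT.
by case/orP=> ->; rewrite ?orbT.
Qed.

Lemma prelude_mem (b c : T) (xs H : seq T) : prelude b c xs H ->
  {subset [:: b, c & xs] <= H}.
Proof. by case=> [x y|x y|x y|x y z] u; rewrite !inE; lia. Qed.

Lemma chain_mem (b c : T) (xs H cs : seq T) : prelude b (last c cs) xs H ->
  {subset xs ++ [:: b, c & cs] <= H ++ zigzag (c :: cs)}.
Proof.
move=> /prelude_mem preH x; rewrite mem_cat in_cons.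
have := preH x; rewrite !inE => preHx; rewrite mem_cat.
case/or3P=> [xs_x|xb|/mem_last_zigzag]; first by rewrite preHx // xs_x !orbT.
  by rewrite preHx // xb.
by rewrite inE => /orP[xE|->]; [rewrite preHx // xE orbT | rewrite orbT].
Qed.

(** The first [d] and the second [c] append one more pair to the zigzag. Being first read at [t] or
    later, [d] differs from all letters of the chain. *)
Lemma chain_ext b c d t : chain b c t -> t <= F d < L c -> L c < size s ->
  chain b d (L c).+1.
Proof.
move=> [xs [H [cs [pre u occ]]]] /andP[td dc] cs_lt.
have ts : t <= size s by lia.
have cE : nth x0 s (L c) = c.
  apply: nth_lst; rewrite -fst_pos_size.
  suff : F c < t by lia.
  apply: mem_occurs occ _ => //; apply: (chain_mem pre).
  by rewrite mem_cat !inE eqxx !orbT.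
have dE : nth x0 s (F d) = d by apply: nth_fst; rewrite -fst_pos_size; lia.
have dnew : d \notin xs ++ [:: b, c & cs].
  by apply/negP => /(chain_mem pre)/(mem_occurs ts occ); lia.
exists xs, H, (c :: cs); split=> //.
  rewrite (perm_uniq (s2 := d :: (xs ++ [:: b, c & cs]))) /= ?dnew //.
  by apply/permP => p; rewrite /= !count_cat /=; lia.
rewrite zigzag_cons2 catA; have := occurs_cat (i := F d) (j := L c) occ.
by rewrite cE dE; apply; lia.
Qed.

(** The second [b] and the second [c] serve as the final [a_0 a_1] and complete a family word. *)
Lemma bad_chain b c t : chain b c t -> t <= L b < L c ->
  b \in s -> c \in s -> bad.
Proof.
move=> [xs [H [cs [pre u occ]]]] /andP[tb bc] bs cs'.
exists (H ++ zigzag [:: b, c & cs]); first by have := bad_family x0 pre u.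
rewrite zigzag_cons2 catA.
have := occurs_cat (i := L b) (j := L c) occ; rewrite !nth_lst // tb bc.
by move/(_ isT)/(occurs_leq _); apply; have := lst_pos_size cs'; lia.
Qed.

Lemma chain_positions P b c xs H t :
  prelude b c xs H -> uniq (xs ++ [:: b; c]) ->
  sorted ltn P -> all (gtn t) P -> map (nth x0 s) P = H -> chain b c t.
Proof.
move=> pre u srt Pt PH; exists xs, H, [::]; split=> //.
by exists P; split=> //; rewrite cats0.
Qed.

Lemma bad_positions pat ls P : pat \in sporadic -> uniq ls ->
  all (gtn (size ls)) pat -> sorted ltn P -> all (gtn (size s)) P ->
  map (nth x0 s) P = map (nth x0 ls) pat -> bad.
Proof.
move=> sp uls pls srt Ps E; exists (map (nth x0 ls) pat).
  exact: bad_sporadic.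
by exists P.
Qed.

Definition nest i t := exists u v, i < F u < F v /\ F v < L u < t.

(* The reasons why [b] cannot have been opened before its successor [c] on the
   stack was read: with [b] open, the second [x] would be read while [c] lies
   above the first one, or the second [u] while [v] is stuck above the first. *)
Definition covered b c t :=
  [\/ exists x, F x < F b /\ F c < L x < t,
      exists x, F b < F x < F c /\ F c < L x < t |
      nest (F c) t].

Lemma uniq_fst ls : uniq (map F ls) -> uniq ls.
Proof. exact: map_uniq. Qed.

(** Side goals for an explicit list of positions: distinct first positions give distinct colors, the
    order is arithmetic, and the letters are looked up. *)
Ltac by_positions := solve
  [ apply: uniq_fst; rewrite /= !inE; lia
  | by move=> /=; lia
  | by rewrite /= !nth_fst // ?nth_lst ].

Lemma fst_neq_lst c d : c \in s -> d \in s -> c != d -> F c <> L d.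
Proof.
by move=> cs ds /eqP cd e; apply: cd; rewrite -(nth_fst x0 cs) e nth_lst.
Qed.

Lemma lst_neq c d : c \in s -> d \in s -> c != d -> L c <> L d.
Proof.
by move=> cs ds /eqP cd e; apply: cd; rewrite -(nth_lst x0 cs) e nth_lst.
Qed.

Lemma neq_fst c d : F c <> F d -> c != d.
Proof. by move=> e; apply/eqP => cd; apply: e; rewrite cd. Qed.

(** Prelude (A) accepts any sock of a third color between the first [b] and the first [c], be it a
    first or a second one; hence a position [p] instead of a color. *)
Lemma chain_A x b p c t : x \in s -> b \in s -> c \in s ->
  F x < F b < p -> p < F c < L x -> L x < t ->
  F (nth x0 s p) <> F x -> F (nth x0 s p) <> F b ->
  t <= size s -> chain b c t.
Proof.
move=> xs bs cs xb pc xt px pb ts; have pmin := @fst_pos_min _ s x0 p.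
apply: (chain_positions (P := [:: F x; F b; p; F c; L x])
          (prelude_A _ _ x (nth x0 s p))); by_positions.
Qed.


(** Each reason in [covered] yields a prelude with [b] as [a_0] and [f] as [a_{n-1}]: the first (A)
    or (B), depending on whether [x] precedes [b], the second (B'), the third (C). *)
Lemma covered_chain b e f :
  covered e f (L e) -> F b < F e < F f -> F f < L e < L b ->
  L e < size s -> b \in s -> chain b f (L e).+1.
Proof.
move=> cef bef feb es bs.
have e_s : e \in s by rewrite -fst_pos_size; lia.
have fs : f \in s by rewrite -fst_pos_size; lia.
have memF x : F x < size s -> x \in s by rewrite fst_pos_size.
case: cef => [[x [xe fx]]|[x [exf fx]]|[u [v [fuv vu]]]].
- have xs : x \in s by apply: memF; lia.
  have [xb|bx|xb] := ltngtP (F x) (F b).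
  + have eE := nth_fst x0 e_s.
    by apply: (chain_A (x := x) (p := F e)) => //; rewrite ?eE; lia.
  + apply: (chain_positions (P := [:: F b; F x; F e; F f; L x; L e])
      (prelude_B b f x e)); by_positions.
  + have xE : x = b by apply: (fst_pos_inj x0) xb; rewrite fst_pos_size.
    by move: fx; rewrite xE; lia.
- have xs : x \in s by apply: memF; lia.
  apply: (chain_positions (P := [:: F b; F e; F x; F f; L x; L e])
      (prelude_B' b f x e)); by_positions.
- have us : u \in s by apply: memF; lia.
  have vs : v \in s by apply: memF; lia.
  apply: (chain_positions (P := [:: F b; F e; F f; F u; F v; L u; L e])
      (prelude_C b f e u v)); by_positions.
Qed.

(** Here [y] recurs below [d] while [f], opened at the second [e], waits for its second sock. The
    three reasons give the last three words of [sporadic], in this order. *)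
Lemma covered_nest_bad e f y d : covered e f (L e) -> F e < F f < L e ->
  L e < F y < F d -> F d < L y < L f -> f \in s -> bad.
Proof.
move=> cef efe eyd dyf fs.
have lt_f := lst_pos_size fs.
have memF x : F x < size s -> x \in s by rewrite fst_pos_size.
have e_s : e \in s by apply: memF; lia.
have ys : y \in s by apply: memF; lia.
have ds : d \in s by apply: memF; lia.
case: cef => [[x [xe fx]]|[x [exf fx]]|[u [v [fuv vu]]]].
- have xs : x \in s by apply: memF; lia.
  apply: (@bad_positions [:: 0; 1; 2; 0; 1; 3; 4; 3; 2] [:: x; e; f; y; d]
    [:: F x; F e; F f; L x; L e; F y; F d; L y; L f]) => //; by_positions.
- have xs : x \in s by apply: memF; lia.
  apply: (@bad_positions [:: 0; 1; 2; 1; 0; 3; 4; 3; 2] [:: e; x; f; y; d]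
    [:: F e; F x; F f; L x; L e; F y; F d; L y; L f]) => //; by_positions.
- have us : u \in s by apply: memF; lia.
  have vs : v \in s by apply: memF; lia.
  apply: (@bad_positions [:: 0; 1; 2; 3; 2; 0; 4; 5; 4; 1]
    [:: e; f; u; v; y; d]
    [:: F e; F f; F u; F v; L u; L e; F y; F d; L y; L f]) => //; by_positions.
Qed.

(** At the second [b] two colors above it, [c] and [k], still wait for a sock, so opening [c] alone
    cannot help. The word found depends on the reason, on the place of [k], and on which of [c] and
    [k] ends first. *)
Lemma covered_bad b c k : covered b c (L b) -> F b < F c < F k -> F k < L b ->
  L b < L c -> L b < L k -> c \in s -> k \in s -> bad.
Proof.
move=> cbc bck kb bc bk cs ks.
have := lst_pos_size cs; have := lst_pos_size ks => lt_k lt_c.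
have memF x : F x < size s -> x \in s by rewrite fst_pos_size.
have bs : b \in s by apply: memF; lia.
have ck : c != k by apply: neq_fst; lia.
have ckL := lst_neq cs ks ck.
(* The word is [b c x k b c k]: family (A) for [n = 2], with [c], [k] as [a_0], [a_1] and [b] as its
   letter [x]. *)
have chain_end p x : p < F k -> nth x0 s p = x -> F c < p -> F x <> F b ->
    F x <> F c -> L c < L k -> bad.
  move=> pk px cp xb xc lt.
  apply: (bad_chain (b := c) (c := k) (t := (L b).+1)) => //.
    by apply: (chain_A (x := b) (p := p)) => //; rewrite ?px; lia.
  by lia.
case: cbc => [[x [xb cx]]|[x [bxc cx]]|[u [v [cuv vu]]]].
- have xs : x \in s by apply: memF; lia.
  have kx : F k <> L x by apply: fst_neq_lst => //; apply: neq_fst; lia.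
  have [lt|le] := ltnP (F k) (L x).
    apply: (bad_chain (b := b) (c := k) (t := L b)) => //; last by lia.
    have cE := nth_fst x0 cs.
    by apply: (chain_A (x := x) (p := F c)) => //; rewrite ?cE; lia.
  have [lt|le'] := ltnP (L c) (L k).
    by apply: (chain_end (L x) x); rewrite ?nth_lst //; try lia.
  apply: (@bad_positions [:: 0; 1; 2; 0; 3; 1; 3; 2] [:: x; b; c; k]
    [:: F x; F b; F c; L x; F k; L b; L k; L c]) => //; by_positions.
- have xs : x \in s by apply: memF; lia.
  have kx : F k <> L x by apply: fst_neq_lst => //; apply: neq_fst; lia.
  have [lt|le] := ltnP (F k) (L x).
    have [lt'|le'] := ltnP (L c) (L k).
      apply: (@bad_positions [:: 0; 1; 2; 3; 1; 0; 2; 3] [:: b; x; c; k]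
        [:: F b; F x; F c; F k; L x; L b; L c; L k]) => //; by_positions.
    apply: (@bad_positions [:: 0; 1; 2; 3; 1; 0; 3; 2] [:: b; x; c; k]
      [:: F b; F x; F c; F k; L x; L b; L k; L c]) => //; by_positions.
  have [lt|le'] := ltnP (L c) (L k).
    by apply: (chain_end (L x) x); rewrite ?nth_lst //; try lia.
  apply: (@bad_positions [:: 0; 1; 2; 1; 3; 0; 3; 2] [:: b; x; c; k]
    [:: F b; F x; F c; L x; F k; L b; L k; L c]) => //; by_positions.
- have us : u \in s by apply: memF; lia.
  have vs : v \in s by apply: memF; lia.
  have ku : k != u by apply/eqP => kE; move: vu bk; rewrite -kE; lia.
  have kuF : F k <> F u.
    by move=> e; case/eqP: ku; apply: (fst_pos_inj x0) e; rewrite fst_pos_size.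
  have kuL := fst_neq_lst ks us ku.
  have [lt_ku|le_ku] := ltnP (F k) (F u).
    have [lt'|le'] := ltnP (L c) (L k).
      apply: (@bad_positions [:: 0; 1; 2; 3; 4; 3; 0; 1; 2] [:: b; c; k; u; v]
        [:: F b; F c; F k; F u; F v; L u; L b; L c; L k]) => //; by_positions.
    apply: (@bad_positions [:: 0; 1; 2; 3; 4; 3; 0; 2; 1] [:: b; c; k; u; v]
      [:: F b; F c; F k; F u; F v; L u; L b; L k; L c]) => //; by_positions.
  have [lt|le'] := ltnP (L c) (L k).
    by apply: (chain_end (F u) u); rewrite ?nth_fst //; try lia.
  (* If [k] is read before the second [u], it can itself serve as the color crossing [u]. *)
  have [lt|le] := ltnP (F k) (L u).
    apply: (@bad_positions [:: 0; 1; 2; 3; 2; 0; 3; 1] [:: b; c; u; k]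
      [:: F b; F c; F u; F k; L u; L b; L k; L c]) => //; by_positions.
  apply: (@bad_positions [:: 0; 1; 2; 3; 2; 4; 0; 4; 1] [:: b; c; u; v; k]
    [:: F b; F c; F u; F v; L u; F k; L b; L k; L c]) => //; by_positions.
Qed.

End Patterns.

(** * The greedy run *)

Section Greedy.
Variables (T : eqType) (s : seq T) (x0 : T).
Hypothesis s_bounded : two_bounded s.
Local Notation F := (fst_pos s).
Local Notation L := (lst_pos s).
Local Notation reach := (reach s x0).
Local Notation bad := (bad s x0).
Local Notation chain := (chain s x0).
Local Notation covered := (covered s).

Definition live t x := F x < t <= L x.

Definition next_live t b c := [/\ live t b, live t c, F b < F c &
  forall d, live t d -> ~~ (F b < F d < F c)].

Lemma live_mem t x : t <= size s -> live t x -> x \in s.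
Proof. by rewrite /live -fst_pos_size; lia. Qed.

Lemma next_live_exists t b c' : t <= size s ->
  live t b -> live t c' -> F b < F c' -> exists c, next_live t b c.
Proof.
move=> ts lb lc bc.
pose P n := has (fun c => [&& live t c, F b < F c & F c == n]) s.
have exP : exists n, P n.
  exists (F c'); apply/hasP; exists c'; first exact: live_mem lc.
  by rewrite lc bc /=.
case: (ex_minnP exP) => _ /hasP[c cs /and3P[lc1 bc1 /eqP <-]] minc.
exists c; split=> // d ld; apply/negP => /andP[bd dc].
suff : F c <= F d by lia.
apply: minc; apply/hasP; exists d; first exact: live_mem ld.
by rewrite ld bd /=.
Qed.

(** Pops the completed colors above the topmost live one; on unread colors [A] is kept. *)
Definition drop_done t (A : pred T) : pred T := fun x =>
  A x && ((t <= F x) || has (fun c => live t c && (F x <= F c)) s).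

(** A top color that is not live is complete and can be popped; induction on the number of colors on
    the stack. *)
Lemma reach_drop_done t (A : pred T) : t <= size s ->
  (forall c, live t c -> A c) -> reach t A None -> reach t (drop_done t A) None.
Proof.
move=> ts; move sz : (size (stk s x0 t A)) => n.
elim: n A sz => [|n IH] A sz liveA rA.
  apply: reach_ext rA => // x xt; rewrite /drop_done.
  suff /negPf-> : ~~ A x by [].
  apply/negP => Ax; have : x \in stk s x0 t A by rewrite mem_stk // Ax.
  by move/size0nil: sz => ->.
case stkE : (stk s x0 t A) => [|y r]; first by rewrite stkE in sz.
have [Ay yt] : A y /\ F y < t.
  by apply/andP; rewrite -(mem_stk x0) // stkE inE eqxx.
have top d : A d -> F d < t -> F d <= F y.
  move=> Ad dt; have : d \in stk s x0 t A by rewrite mem_stk // Ad.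
  have := stk_sorted x0 A ts; rewrite stkE /= => /andP[/allP yr _].
  by rewrite inE => /predU1P[-> //|/yr /ltnW].
have [ly|nly] := boolP (live t y).
  apply: reach_ext rA => // x xt; rewrite /drop_done.
  case Ax: (A x) => //=; apply/esym/orP; right; apply/hasP; exists y.
    exact: live_mem ly.
  by rewrite ly top.
have Ly : L y < t by move: nly; rewrite /live yt /= -ltnNge.
pose B : pred T := fun x => A x && (x != y).
have stkB : stk s x0 t A = y :: stk s x0 t B by apply: stk_top.
have rB : reach t B None by apply: reach_take_top.
apply: (reach_ext ts _ (IH B _ _ rB)).
- move=> x xt; rewrite /drop_done /B -andbA; case Ax: (A x) => //=.
  have [->|//] := eqVneq x y; apply/esym/negbTE; rewrite negb_or -ltnNge yt /=.
  apply/hasPn => c cs; apply/negP => /andP[lc yc].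
  have cy : F c <= F y by apply: top; [apply: liveA | case/andP: lc].
  have e : F c = F y by apply/eqP; rewrite eqn_leq cy yc.
  have cE : c = y by apply: (fst_pos_inj x0) e; rewrite fst_pos_size.
  by rewrite -cE lc in nly.
- by move: sz; rewrite stkB => -[].
- move=> c lc; rewrite /B liveA //=; apply: contraNneq nly => <-.
  exact: lc.
Qed.


(** For neighboring live colors this says that no completed color is stuck between them. *)
Definition clean (A : pred T) b c := forall d, A d -> ~~ (F b < F d < F c).

(* The stack that results from opening [b] at the time [c] is first read. *)
Definition opened (A : pred T) b c : pred T :=
  fun x => (F c <= F x) || (A x && (F x < F b)).

(* [T0] is the time of the last crossing: a pair [b], [c] adjacent on the stack
   with [c] first read after [T0] may still be resolved by having opened [b]. *)
Definition closed_mode t A : Prop := exists T0,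
  [/\ T0 <= t, reach t A None,
      forall x, x \in s -> t <= L x -> A x,
      forall x, A x -> F x < t -> exists2 c, live t c & F x <= F c &
      forall b c, next_live t b c -> chain b c T0 \/ clean A b c /\
        (covered b c t \/ T0 <= F c /\ reach t (opened A b c) (Some b))].

(* [f] has been opened at the second sock of [e], which lay just below it. *)
Definition open_mode t A e f : Prop :=
  [/\ [/\ L e < t, t <= L f, F e < F f < L e & covered e f (L e)],
      reach t A (Some f),
      forall x, x \in s -> t <= L x -> x != f -> A x,
      forall x, live t x -> [\/ F x < F e, x = f | L e < F x] &
      forall b c, next_live t b c -> F c < F e ->
        chain b c (L e).+1 \/ clean A b c /\ covered b c t].

Lemma covered_leq b c t t' : t <= t' -> covered b c t -> covered b c t'.
Proof.
move=> tt' [[x [? ?]]|[x [? ?]]|[u [v [? ?]]]].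
- by constructor 1; exists x; split=> //; lia.
- by constructor 2; exists x; split=> //; lia.
- by constructor 3; exists u, v; split=> //; lia.
Qed.

Lemma clean_sub (A B : pred T) b c : (forall x, F x < F c -> B x -> A x) ->
  clean A b c -> clean B b c.
Proof.
move=> BA cA d Bd; apply/negP => /andP[bd dc].
by have := cA d (BA d dc Bd); rewrite bd dc.
Qed.

Lemma closed_mode_start : closed_mode 0 predT.
Proof.
exists 0; split=> //; first exact: reach_start.
by move=> b c [].
Qed.

Section Step.
Variable t : nat.
Hypothesis t_lt : t < size s.
Let y := nth x0 s t.

Let ts : t <= size s. Proof. exact: ltnW. Qed.
Let ys : y \in s. Proof. exact: mem_nth. Qed.

Let yFL : t = F y \/ t = L y. Proof. exact: two_bounded_pos. Qed.

Let yFt : F y <= t. Proof. exact: fst_pos_min. Qed.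
Let ytL : t <= L y. Proof. exact: lst_pos_max. Qed.

Let F_y x : F x = t -> x = y.
Proof. by move=> e; rewrite /y -e nth_fst // -fst_pos_size e. Qed.

Let L_y x : x \in s -> L x = t -> x = y.
Proof. by move=> xs e; rewrite /y -e nth_lst. Qed.

Let F_inj x z : F x < size s -> F x = F z -> x = z.
Proof. exact: fst_pos_inj. Qed.

Let ltF_neq x z : F x < F z -> x != z.
Proof. by apply: contraTneq => ->; rewrite ltnn. Qed.

Let gtF_neq x z : F z < F x -> x != z.
Proof. by apply: contraTneq => ->; rewrite ltnn. Qed.

Let nbtw i j k : ~~ (i < j < k) -> i < j -> k <= j.
Proof. by move=> nijk ij; rewrite ij -leqNgt in nijk. Qed.

Let liveS x : live t.+1 x -> (F x = t \/ live t x) /\ t < L x.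
Proof. by rewrite /live; lia. Qed.

Let live_S x : live t x -> x != y -> live t.+1 x.
Proof.
move=> lx xy; have xs := live_mem ts lx.
have : L x <> t by move=> /(L_y xs)/eqP; apply/negP.
by move: lx; rewrite /live; lia.
Qed.

Let live_dec b c : live t.+1 b -> live t.+1 c -> F b < F c -> live t b.
Proof. by rewrite /live; lia. Qed.

(** No crossing occurs here: [y] is new or has no live color above it. What needs care is the status
    of each neighboring pair. *)
Lemma closed_mode_step A : closed_mode t A ->
  (F y < t -> forall c, live t c -> F c <= F y) ->
  closed_mode t.+1 (drop_done t.+1 A).
Proof.
move=> [T0 [T0t rA liveA topA st]] ytop.
have AS c : live t.+1 c -> A c.
  by move=> lc; apply: liveA; [apply: live_mem lc | case/liveS: lc => _ /ltnW].
have dropE b x : live t.+1 b -> F x < F b -> drop_done t.+1 A x = A x.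
  move=> lb xb; rewrite /drop_done; case: (A x) => //=; apply/orP; right.
  by apply/hasP; exists b; [apply: live_mem lb | rewrite lb ltnW].
exists T0; split; first exact: leqW.
- apply: reach_drop_done => //; apply: reach_push => //; first exact: liveA.
  move=> yt d Ad dt; have [c lc dc] := topA d Ad dt.
  exact: leq_trans dc (ytop yt c lc).
- move=> x xs xt; rewrite /drop_done liveA //=; last exact: ltnW.
  have [//|/= lt] := leqP t.+1 (F x); apply/hasP; exists x => //.
  by rewrite /live lt xt leqnn.
- move=> x /andP[_ /orP[|/hasP[c cs /andP[lc xc]] _]]; last by exists c.
  by rewrite leqNgt => /negPf->.
move=> b c [lb lc bc btw].
have lb' := live_dec lb lc bc; have Ab := AS _ lb; have [bt tb] := andP lb'.
have [_ tLb] := liveS lb; have [ct tLc] := liveS lc.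
have cleanS : clean A b c -> clean (drop_done t.+1 A) b c.
  by apply: clean_sub => x _ /andP[].
have openedE x : opened A b c x = opened (drop_done t.+1 A) b c x.
  rewrite /opened; have [xb|] := ltnP (F x) (F b); last by rewrite !andbF.
  by rewrite (dropE b).
case: ct => [Fc|lc'].
  (* [c] is the sock just read, so [b] was on top and could be opened right before it. *)
  have cy := F_y Fc.
  have topb d : A d -> F d < t -> F d <= F b.
    move=> Ad dt; have [g lg dg] := topA d Ad dt; apply: leq_trans dg _.
    have gy : g != y.
      apply: contraTneq lg => ->; rewrite -cy /live Fc; lia.
    have := btw g (live_S lg gy); rewrite Fc.
    by case/andP: lg => -> _; rewrite andbT -leqNgt.
  right; split.
    move=> d /andP[Ad _]; rewrite Fc; apply/negP => /andP[bd dt].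
    by have := topb d Ad dt; lia.
  right; rewrite Fc; split=> //.
  pose B : pred T := fun x => A x && (x != b).
  have rB : reach t B (Some b) by apply: reach_take_top.
  have yb : y != b by rewrite -cy; apply: gtF_neq.
  have rB' : reach t.+1 B (Some b).
    apply: reach_push => //; rewrite -/y; last by rewrite -cy Fc ltnn.
    by rewrite /B liveA.
  apply: reach_ext rB' => // x; rewrite ltnS leq_eqVlt => /predU1P[xt|xt].
    by rewrite /opened /B Fc xt leqnn (F_y xt) yb liveA.
  rewrite -openedE /opened Fc leqNgt xt /=; rewrite /B.
  case Ax: (A x) => //=; have := topb x Ax xt; rewrite leq_eqVlt.
  case/predU1P=> [xb|xb].
    rewrite (F_inj _ xb) ?eqxx ?ltnn //.
    exact: leq_trans xt ts.
  by rewrite xb; apply: ltF_neq.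
have nbc : next_live t b c.
  split=> // d ld; apply/negP => bdc; have := btw d.
  rewrite bdc => /(_ _)/negP; apply=> //; apply: live_S => //.
  apply/eqP => dy; move: bdc ld; rewrite dy => bdc ld.
  have yt : F y < t by case/andP: ld.
  by have := ytop yt c lc'; lia.
case: (st b c nbc) => [?|[cl bc_st]]; first by left.
right; split; first exact: cleanS.
case: bc_st => [/(covered_leq (leqnSn t))|[T0c rbc]]; first by left.
(* In the alternative schedule with [b] opened, completed colors above [c] are still on the stack.
   If one of them lies above [y], that schedule fails and the third reason appears. *)
have [/hasP[d ds /and4P[od dt yd yt]]|noned] :=
    boolP (has (fun d => [&& opened A b c d, F d < t, F y < F d & F y < t]) s).
  left; constructor 3; exists y, d.
  have cy := ytop yt c lc'.
  have ncy : F c <> F y.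
    move=> e; have cy' : c = y.
      by apply: F_inj e; rewrite fst_pos_size (live_mem _ lc').
    by move: tLc yFL; rewrite cy'; move: yt; lia.
  by case: yFL yt => [->|->]; rewrite ?ltnn //; lia.
right; split=> //.
have : reach t.+1 (opened A b c) (Some b).
  apply: reach_push => //; rewrite -/y.
    rewrite /opened; apply/orP; left.
    case: (yFL) => [<-|]; first by case/andP: lc' => /ltnW.
    case: (ltnP (F y) t) => [yt _|yt _]; first exact: ytop.
    by case/andP: lc' => ? _; lia.
  move=> yt d od dt; rewrite leqNgt; apply/negP => yd.
  case/hasP: noned; exists d; last by rewrite od dt yd yt.
  by rewrite -fst_pos_size; lia.
by apply: reach_ext => // x _; apply: openedE.
Qed.

(** The second [b], read after [c], is a crossing nested above [h]: the third reason replaces a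
    pending alternative for [g]. *)
Lemma status_below A T0 b c g h : T0 <= t -> next_live t b c -> L b = t ->
  next_live t g h -> F h < F b ->
  chain g h T0 \/ clean A g h /\
    (covered g h t \/ T0 <= F h /\ reach t (opened A g h) (Some g)) ->
  chain g h t.+1 \/ clean A g h /\ covered g h t.+1.
Proof.
move=> T0t [lb lc bc _] Lb ngh hb [cgh|[cl [cgh|_]]].
- by left; apply: chain_leq cgh; apply: leqW.
- by right; split=> //; apply: covered_leq cgh.
- right; split=> //; constructor 3; exists b, c.
  by case/andP: lc => ct _; rewrite hb bc Lb ct /=.
Qed.

Lemma next_live_pred g h b : next_live t.+1 g h -> live t h -> b = y ->
  ~~ (F g < F b < F h) -> next_live t g h.
Proof.
move=> [lg lh gh btw] lh' -> nb; split=> //; first exact: live_dec gh.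
move=> d ld; have [->//|dy] := eqVneq d y.
by apply: btw; apply: live_S.
Qed.

(** The status of the pair [y], [c] decides: a chain becomes a bad word; a covered pair leaves only
    the opening of [c], for which [c] must be the topmost live color; otherwise the alternative with
    [y] opened is adopted. *)
Lemma crossing_step A c' : closed_mode t A -> F y < t -> live t y ->
  live t c' -> F y < F c' ->
  [\/ bad, exists A', closed_mode t.+1 A'
    | exists A' e f, open_mode t.+1 A' e f].
Proof.
move=> [T0 [T0t rA liveA topA st]] yt ly lc' yc'.
have [c nyc] := next_live_exists ts ly lc' yc'; have [_ lc yc btw] := nyc.
have cs := live_mem ts lc; have /andP[ct tLc'] := lc.
have Ly : L y = t by case: (yFL); lia.
have tLc : t < L c.
  have : L c <> t by move=> /(L_y cs) e; move: yc; rewrite e ltnn.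
  lia.
have old x : live t.+1 x -> live t x /\ x != y.
  move=> lx; have [[/F_y xy|lx'] tLx] := liveS lx.
    by move: tLx; rewrite xy Ly ltnn.
  by split=> //; apply: contraTneq tLx => ->; rewrite Ly ltnn.
have below g h (ngh : next_live t.+1 g h) : F h < F y ->
    next_live t g h /\ (chain g h t.+1 \/ clean A g h /\ covered g h t.+1).
  move=> hy; have [lg lh gh _] := ngh.
  have ngh' : next_live t g h.
    apply: (next_live_pred ngh (old h lh).1 (erefl y)); lia.
  split=> //; apply: (status_below T0t nyc Ly ngh' hy); exact: st.
case: (st y c nyc) => [ch|[cl [cyc|[T0c ryc]]]].
- by constructor 1; apply: bad_chain ch _ _ _ => //; rewrite Ly; lia.
- have [/hasP[k ks /andP[lk ck]]|top] :=
      boolP (has (fun k => live t k && (F c < F k)) s).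
    constructor 1; have /andP[kt tLk] := lk.
    have : L k <> t by move=> /(L_y ks) e; move: yc; rewrite -e; lia.
    by move=> ?; apply: (@covered_bad _ s x0 y c k); rewrite ?Ly //; lia.
  have topc k : live t k -> F k <= F c.
    move=> lk; rewrite leqNgt; apply: contra top => ck.
    by apply/hasP; exists k; [apply: live_mem lk | rewrite lk].
  have topA' d : A d -> F d < t -> F d <= F c.
    move=> Ad dt; have [g lg dg] := topA d Ad dt.
    exact: leq_trans dg (topc _ lg).
  (* Popping [c] opens it and uncovers [y], which then receives its second sock. *)
  constructor 3; pose B : pred T := fun x => A x && (x != c).
  exists B, y, c; split.
  + by split; rewrite ?Ly //; lia.
  + have yc_neq := ltF_neq yc.
    have Ac : A c by apply: liveA.
    have Ay : A y by apply: liveA; rewrite ?Ly.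
    apply: reach_push => //; rewrite -/y; first by rewrite /B Ay.
      move=> _ d /andP[Ad dc] dt; have := topA' d Ad dt; rewrite leq_eqVlt.
      case/predU1P=> [e|lt].
        by rewrite (F_inj _ e) ?eqxx // in dc; apply: leq_trans dt ts.
      by have := cl d Ad; rewrite lt andbT -leqNgt.
    exact: reach_take_top.
  + by move=> x xs xt xc; rewrite /B xc liveA // ltnW.
  + move=> x lx; have [lx' xy] := old x lx.
    have [|yx|e] := ltngtP (F x) (F y); first by constructor 1.
      constructor 2; apply: F_inj; first by rewrite fst_pos_size (live_mem ts).
      apply/eqP; rewrite eqn_leq topc //; exact: nbtw (btw x lx') yx.
    by rewrite (F_inj _ e) ?eqxx // ?fst_pos_size ?(live_mem ts) in xy.
  + move=> g h ngh hy; rewrite Ly; have [_ [?|[clgh cvgh]]] := below g h ngh hy.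
      by left.
    by right; split=> //; apply: clean_sub clgh => x _ /andP[].
- constructor 2; pose A1 := opened A y c; exists (drop_done t.+1 A1).
  have A1_live x : x \in s -> t.+1 <= L x -> A1 x.
    move=> xs tx; rewrite /A1 /opened.
    have [//|xc /=] := leqP (F c) (F x); rewrite liveA ?(ltnW tx) //=.
    have lx : live t x by rewrite /live; lia.
    have := btw x lx; rewrite xc andbT -leqNgt leq_eqVlt => /predU1P[e|//].
    by move: tx; rewrite (F_inj _ e) ?fst_pos_size // Ly ltnn.
  have A1A h x : F x < F h -> F h <= F c -> A1 x -> A x.
    by move=> xh hc /orP[|/andP[//]]; lia.
  have dropA1 x : drop_done t.+1 A1 x -> A1 x by case/andP.
  (* The run is now committed to having opened [y], so only pairs whose upper color comes later keep
     an alternative. *)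
  exists t.+1; split=> //.
  + apply: reach_drop_done => //; last exact: reach_close ryc.
    by move=> x lx; apply: A1_live; [apply: live_mem lx | case/andP: lx].
  + move=> x xs tx; rewrite /drop_done A1_live //=.
    have [//|/= lt] := leqP t.+1 (F x); apply/hasP; exists x => //.
    by rewrite /live lt tx leqnn.
  + move=> x /andP[_ /orP[|/hasP[k ks /andP[lk xk]] _]]; last by exists k.
    by rewrite leqNgt => /negPf->.
  move=> g h ngh; have [lg lh gh btw'] := ngh.
  have [lg' gy] := old g lg; have [lh' hy'] := old h lh.
  have gs := live_mem ts lg'; have hs := live_mem ts lh'.
  have side x : x \in s -> x != y -> F x < F y \/ F y < F x.
    move=> xs /eqP xy; case: ltngtP => // [||e]; [by left|by right|].
    by case: xy; apply: F_inj e; rewrite fst_pos_size.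
  case: (side h hs hy') => [hy|yh].
    have [_ [?|[clgh cvgh]]] := below g h ngh hy; first by left.
    right; split; last by left.
    apply: clean_sub clgh => x xh /dropA1; apply: A1A xh _.
    exact: ltnW (ltn_trans hy yc).
  case: (side g gs gy) => [gy_lt|yg].
    have hc : h = c.
      apply: F_inj; first by rewrite fst_pos_size.
      have lcS : live t.+1 c by apply: live_S => //; apply: gtF_neq.
      apply/eqP; rewrite eqn_leq (nbtw (btw h lh') yh) andbT.
      exact: nbtw (btw' c lcS) (ltn_trans gy_lt yc).
    have ngy : next_live t g y.
      split=> // d ld; apply/negP => /andP[gd dy].
      have dny := ltF_neq dy.
      have := nbtw (btw' d (live_S ld dny)) gd.
      by rewrite leqNgt (ltn_trans dy yh).
    have clean_gc : clean A g y -> clean (drop_done t.+1 A1) g c.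
      move=> clgy d /dropA1 /orP[cd|/andP[Ad dy]].
        by rewrite negb_and -(leqNgt (F c)) cd orbT.
      by have := clgy d Ad; rewrite dy andbT negb_and => ->.
    (* For the pair around [y], a chain from [g] to [y] is prolonged to [c]; otherwise [y] is the
       second reason. *)
    rewrite hc; case: (st g y ngy) => [ch|[clgy _]].
      left; rewrite -Ly; apply: (chain_ext ch); rewrite ?Ly //.
      by rewrite T0c.
    right; split; first exact: clean_gc.
    by left; constructor 2; exists y; rewrite Ly gy_lt yc ct ltnSn.
  (* Both colors lie above [y]: a completed color between them gives prelude (A) with [y] as its
     letter [x]; otherwise [y] is the first reason. *)
  have /andP[ht _] := lh'.
  have [/hasP[d ds /and3P[Ad gd dh]]|none] :=
      boolP (has (fun d => [&& drop_done t.+1 A1 d, F g < F d & F d < F h]) s).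
    left; have dE := nth_fst x0 ds.
    apply: (@chain_A _ s x0 y g (F d) h); rewrite ?dE //.
    - by rewrite yg.
    - by rewrite dh Ly.
    - by rewrite Ly.
    - by move: yg gd; clear; lia.
    - by move: gd; clear; lia.
  right; split.
    move=> d Ad; apply/negP => /andP[gd dh]; case/hasP: none; exists d.
      by rewrite -fst_pos_size (ltn_trans dh) // (ltn_trans ht).
    by rewrite Ad gd dh.
  by left; constructor 1; exists y; rewrite Ly yg ht ltnSn.
Qed.

(** Until [f] recurs only pushes are possible. They go wrong if a color below [e] recurs, which
    completes a family word, or if a color first read after the second [e] recurs while covered,
    which gives a sporadic word. *)
Lemma open_mode_step A e f : open_mode t A e f ->
  [\/ bad, exists A', closed_mode t.+1 A'
    | exists A' e f, open_mode t.+1 A' e f].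
Proof.
move=> [[et tf efe cef] rA liveA liveP st].
have fs : f \in s by rewrite -fst_pos_size; lia.
have Fft : F f < t by lia.
have stepA : y != f ->
    (F y < t -> L e < F y /\ forall d, A d -> F d < t -> F d <= F y) ->
    exists A' e f, open_mode t.+1 A' e f.
  move=> yf ytop; exists A, e, f; split.
  - split=> //; first exact: ltnW.
    have : L f <> t by move=> /(L_y fs) fy; rewrite fy eqxx in yf.
    by lia.
  - apply: reach_push => //; rewrite -/y; first exact: liveA.
    by move=> /ytop[].
  - by move=> x xs xt; apply: liveA => //; apply: ltnW.
  - by move=> x /liveS[[xt|/liveP //] _]; constructor 3; rewrite xt.
  - move=> b c nbc ce; have [lb lc bc _] := nbc.
    have lc' : live t c by move: lc; rewrite /live; lia.
    have nbc' : next_live t b c.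
      apply: (next_live_pred nbc lc' (erefl y)).
      have [->|ne] := eqVneq (F y) t; first by lia.
      have /ytop[] : F y < t by lia.
      by lia.
    case: (st b c nbc' ce) => [|[cl cv]]; [by left | right; split=> //].
    exact: covered_leq cv.
have [yf|yf] := eqVneq y f; last first.
  have [yt|ty] := ltnP (F y) t; last by constructor 3; apply: stepA => //; lia.
  have Ly : L y = t by case: (yFL); lia.
  have ly : live t y by rewrite /live yt Ly leqnn.
  have Lf : L f <> t by move=> /(L_y fs) fy; rewrite fy eqxx in yf.
  case: (liveP y ly) => [ye|yE|ey].
  - constructor 1; apply: (@bad_chain _ s x0 y f (L e).+1) => //.
      by apply: covered_chain => //; lia.
    by lia.
  - by rewrite yE eqxx in yf.
  have [/hasP[d ds /and3P[Ad yd dt]]|none] :=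
      boolP (has (fun d => [&& A d, F y < F d & F d < t]) s).
    by constructor 1; apply: (@covered_nest_bad _ s x0 e f y d) => //; lia.
  constructor 3; apply: stepA => // _; split=> // d Ad dt; rewrite leqNgt.
  apply/negP => yd; case/hasP: none; exists d; last by rewrite Ad yd dt.
  by rewrite -fst_pos_size; lia.
have Lf : L f = t.
  by rewrite -yf; case: (yFL) => // ty; move: Fft; rewrite -yf; lia.
have old x : live t.+1 x -> live t x /\ x != f.
  move=> lx; have [[/F_y xy|lx'] tLx] := liveS lx.
    by move: tLx; rewrite xy yf Lf ltnn.
  by split=> //; apply: contraTneq tLx => ->; rewrite Lf ltnn.
have liveA' x : x \in s -> t.+1 <= L x -> A x.
  move=> xs tx; apply: liveA => //; first exact: ltnW.
  by apply: contraTneq tx => ->; rewrite Lf ltnn.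
have drop_sub g h : clean A g h -> clean (drop_done t.+1 A) g h.
  by apply: clean_sub => x _ /andP[].
constructor 2; exists (drop_done t.+1 A), t.+1; split=> //.
- apply: reach_drop_done => //.
    by move=> x lx; apply: liveA'; [apply: live_mem lx | case/andP: lx].
  by apply: reach_close => //; rewrite -/y yf.
- move=> x xs tx; rewrite /drop_done liveA' //=.
  have [//|/= lt] := leqP t.+1 (F x); apply/hasP; exists x => //.
  by rewrite /live lt tx leqnn.
- move=> x /andP[_ /orP[|/hasP[k ks /andP[lk xk]] _]]; last by exists k.
  by rewrite leqNgt => /negPf->.
move=> g h ngh; have [lg lh gh btw'] := ngh.
have [lg' gf] := old g lg; have [lh' hf] := old h lh.
have gs := live_mem ts lg'; have hs := live_mem ts lh'.
have [/andP[gt tLg] /andP[ht tLh]] := (lg', lh').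
have side x : live t x -> x != f -> F x < F e \/ L e < F x.
  by move=> lx xf; case: (liveP x lx) => [||] ?; [left|case/eqP: xf|right].
have /andP[ef fe] := efe.
case: (side h lh' hf) => [he|eh].
  have ngh' : next_live t g h.
    apply: (next_live_pred ngh lh' (erefl y)); rewrite yf.
    by rewrite negb_and -!leqNgt (ltnW (ltn_trans he ef)) orbT.
  case: (st g h ngh' he) => [ch|[cl cv]].
    by left; apply: chain_leq ch; apply: ltnW.
  by right; split; [apply: drop_sub | left; apply: covered_leq cv].
case: (side g lg' gf) => [ge|eg].
  (* The opening of [f] created a chain from [g] to [f]; as [h] crosses [f], it is prolonged to
     [h]. *)
  left; rewrite -Lf; apply: (@chain_ext _ s x0 g f h (L e).+1).
  - apply: covered_chain => //.
    + by rewrite ge ef.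
    + by rewrite fe (leq_trans et tLg).
    + exact: ltn_trans et t_lt.
  - by rewrite eh Lf.
  - by rewrite Lf.
have fg := ltn_trans fe eg.
have [/hasP[d ds /and3P[Ad gd dh]]|none] :=
    boolP (has (fun d => [&& drop_done t.+1 A d, F g < F d & F d < F h]) s).
  left; have dE := nth_fst x0 ds.
  apply: (@chain_A _ s x0 f g (F d) h); rewrite ?dE //.
  - by rewrite fg.
  - by rewrite dh Lf.
  - by rewrite Lf.
  - by move: fg gd; clear; lia.
  - by move: gd; clear; lia.
right; split.
  move=> d Ad; apply/negP => /andP[gd dh]; case/hasP: none; exists d.
    by rewrite -fst_pos_size (ltn_trans dh) // (ltn_trans ht).
  by rewrite Ad gd dh.
by left; constructor 1; exists f; rewrite Lf fg ht ltnSn.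
Qed.

End Step.

Lemma sortable_or_bad : foot_sortable s \/ bad.
Proof.
suff inv t : t <= size s ->
    [\/ bad, exists A, closed_mode t A | exists A e f, open_mode t A e f].
  case: (inv (size s) (leqnn _)) => [|[A [T0 [_ rA _ topA _]]]|[A [e [f]]]].
  - by right.
  (* Nothing is live after the last sock, so the stack is empty. *)
  - left; apply: reach_sortable rA => x xs; apply/negP => Ax.
    have [c lc _] := topA x Ax xs; have cs := live_mem (leqnn _) lc.
    by have := lst_pos_size cs; case/andP: lc; lia.
  - case=> [[es sf efe _] _ _ _ _].
    have fs : f \in s by rewrite -fst_pos_size; lia.
    by have := lst_pos_size fs; lia.
elim: t => [|t IH] t_lt.
  by constructor 2; exists predT; apply: closed_mode_start.
case: (IH (ltnW t_lt)) => [|[A cA]|[A [e [f oA]]]].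
- by constructor 1.
- set y := nth x0 s t.
  have [yt|ty] := ltnP (F y) t; last first.
    constructor 2; exists (drop_done t.+1 A); apply: closed_mode_step => //.
    by rewrite -/y ltnNge ty.
  have [/hasP[c cs /andP[lc yc]]|none] :=
      boolP (has (fun c => live t c && (F y < F c)) s).
    apply: (@crossing_step t t_lt A c cA) => //.
    by rewrite /live yt lst_pos_max.
  constructor 2; exists (drop_done t.+1 A); apply: closed_mode_step => //.
  move=> _ c lc; rewrite leqNgt; apply: contra none => yc; apply/hasP.
  by exists c; [apply: live_mem lc; apply: ltnW | rewrite lc].
- exact: open_mode_step oA.
Qed.

End Greedy.

(** * Minimality of the listed words *)

(* The tail of the families in reading order: [c] is [a_{n-1}] and [ds] lists
   [a_{n-2}], ..., [a_0]. *)
Fixpoint chain_word (T : Type) (c : T) (ds : seq T) : seq T :=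
  if ds is d :: ds' then [:: d, c & chain_word d ds'] else [::].

Lemma zigzag_rcons2 (T : Type) (l : seq T) d c :
  zigzag (rcons (rcons l d) c) = [:: d, c & zigzag (rcons l d)].
Proof.
elim: l => [|a l IH] //; have [e [m mE]] : exists e m, rcons l d = e :: m.
  by case: (l) => [|e m]; [exists d, [::] | exists e, (rcons m d)].
by move: IH; rewrite /= mE /= => ->.
Qed.

Lemma zigzag_rev (T : Type) (c : T) ds :
  zigzag (rev (c :: ds)) = chain_word c ds.
Proof.
elim: ds c => [|d ds IH] c //=.
by rewrite -IH !rev_cons zigzag_rcons2.
Qed.

(** * Non-sortability: a stuck color persists along the tail *)

Section ChainWord.
Variable T : eqType.
Implicit Types (a b c d D : T) (ds st out o r l u v w xs : seq T).

(** The two ends [c] and [last c ds] each lack one occurrence, which the prelude supplies. *)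
Lemma count_chain_word a c ds :
  count_mem a (chain_word c ds) + (c == a) + (last c ds == a) =
  (count_mem a (c :: ds)).*2.
Proof.
by elim: ds c => [|d ds IH] c /=; [lia | have := IH d; rewrite /=; lia].
Qed.

Lemma subseq_catE u v w : subseq u (v ++ w) ->
  exists u1 u2, [/\ u = u1 ++ u2, subseq u1 v & subseq u2 w].
Proof.
elim: v u => [|x v IH] u; first by exists [::], u.
case: u => [|y u] /=; first by exists [::], [::]; rewrite !sub0seq.
case: eqP => [->|ne] /IH [u1 [u2 [uE s1 s2]]].
  by exists (x :: u1), u2; rewrite uE /= eqxx.
exists u1, u2; split=> //.
exact: subseq_trans s1 (subseq_cons _ _).
Qed.

Lemma aba_later u v a b : aba_free (u ++ v) -> subseq [:: a; b] u -> a \in v ->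
  a = b.
Proof.
move=> aba sub av; apply: aba; rewrite -[[:: a; b; a]]/([:: a; b] ++ [:: a]).
by apply: cat_subseq => //; rewrite sub1seq.
Qed.

Lemma aba_free_cat u v : aba_free (u ++ v) -> aba_free u /\ aba_free v.
Proof.
move=> aba; split=> a b sub; apply: aba.
  exact: subseq_trans sub (prefix_subseq _ _).
exact: subseq_trans sub (suffix_subseq _ _).
Qed.

(* The color [D] stuck between [c] and [a_0] stays stuck when [d] takes over the
   role of [c]: either [c] is popped before [d] is read and [d] ends up in its
   place, or [d] is output first and nothing more can be popped before the next
   [d]. *)
Lemma chain_word_stuck D c ds out st out' : D \notin c :: ds ->
  uniq (c :: ds) -> foot_run (chain_word c ds) st out' ->
  aba_free (out ++ out') ->
  subseq [:: c; D; last c ds] st \/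
  (exists2 o, out = rcons o c & subseq [:: D; last c ds] st) -> False.
Proof.
elim: ds c out st out' => [|d ds IH] c out st out'.
  rewrite inE => /eqP Dc _ /foot_run_stack_subseq st_out aba stuck.
  apply: Dc; apply/esym/aba; case: stuck => /= [sub|[o -> sub]].
    exact: subseq_trans (subseq_trans sub st_out) (suffix_subseq _ _).
  rewrite -cats1 -catA -[[:: c; D; c]]/([::] ++ [:: c] ++ [:: D; c]).
  apply: cat_subseq (sub0seq _) _; apply: cat_subseq => //.
  exact: subseq_trans sub st_out.
rewrite inE negb_or => /andP[Dc Dds] /andP[]; rewrite inE negb_or.
move=> /andP[cd cds] uds run; have /= := run.
move=> /foot_run_cons[st1 [st2 [out2 [-> -> /foot_run_cons]]]].
(* [st1] is popped before [d] is read, and [st3] between [d] and [c]. *)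
move=> [st3 [st4 [out3 [stE -> run']]]] aba stuck.
set b := last c (d :: ds) in stuck.
have bE : b = last d ds by [].
have sub3 := foot_run_stack_subseq run'.
have c3 : c \in out3 by apply: (mem_subseq sub3); rewrite inE eqxx.
have aba' : aba_free ((out ++ st1 ++ st3) ++ out3) by rewrite -!catA.
have later3 a : a \in out3 -> subseq [:: a; D] (out ++ st1 ++ st3) -> a = D.
  by move=> aout sub; apply: aba_later aba' sub aout.
have cD : subseq [:: c; D] (out ++ st1 ++ st3) -> False.
  by move=> /(later3 c c3) e; rewrite e eqxx in Dc.
have cdF : subseq [:: c; d] (out ++ st1 ++ st3) -> False.
  by move=> /(aba_later aba')/(_ c3) e; rewrite e eqxx in cd.
have d_later : b \in c :: st4 -> d \in out3.
  rewrite (perm_mem (foot_run_perm run')) mem_cat bE.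
  by case: (ds) => [|e ds' _] /=; [move=> -> | rewrite !inE eqxx orbT].
have next_closed : subseq [:: D; b] st2 -> st3 = [::] -> False.
  move=> sub st30; apply: (IH d _ _ _ Dds uds run' aba'); left.
  have -> : st4 = d :: st2 by move: stE; rewrite st30.
  apply: subseq_trans _ (subseq_cons _ _).
  by rewrite /= eqxx.
(* If [d] is popped, it must be the last color output, since any other color after it would separate
   it from its later sock. *)
have next_open : subseq [:: D; b] st4 ->
    (exists st3', st3 = d :: st3') -> False.
  move=> sub [st3' st3E]; apply: (IH d _ _ _ Dds uds run' aba'); right.
  exists (out ++ st1 ++ belast d st3'); last first.
    exact: subseq_trans sub (subseq_cons _ _).
  rewrite st3E !rcons_cat; congr (_ ++ (_ ++ _)).
  rewrite [in LHS]lastI; congr rcons.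
  have [//|/eqP ne] := eqVneq (last d st3') d; case: (ne); apply/esym.
  apply: (aba_later aba'); last first.
    apply: d_later; rewrite inE; apply/orP; right.
    by apply: (mem_subseq sub); rewrite !inE eqxx orbT.
  rewrite st3E; do 2!apply: subseq_trans _ (suffix_subseq _ _).
  rewrite /= eqxx sub1seq.
  by have := mem_last d st3'; rewrite inE => /predU1P[/ne|].
have sub_cons2 a a' u v : subseq [:: a] u -> subseq [:: a'] v ->
    subseq [:: a; a'] (u ++ v).
  exact: (@cat_subseq _ [:: a] [:: a'] u v).
have st3_dec : (exists st3', st3 = d :: st3') \/ st3 = [::].
  case: (st3) stE => [|e st3'] /= stE; first by right.
  by left; case: stE => ->; exists st3'.
case: stuck => [sub|[o oE sub]].
  have [[|a u1] [u2 [/= uE s1 s2]]] := subseq_catE sub; last first.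
    case: uE => aE; case: u1 s1 => [|a' u1] s1 uE.
      case: st3_dec => [[st3' st3E]|]; last by apply: next_closed; rewrite uE.
      apply: cdF; apply: subseq_trans _ (suffix_subseq _ _).
      by apply: sub_cons2; rewrite ?aE // st3E sub1seq inE eqxx.
    case: uE => DE _; apply: cD; apply: subseq_trans _ (suffix_subseq _ _).
    apply: subseq_trans _ (prefix_subseq _ _); apply: subseq_trans s1.
    by rewrite aE DE /= !eqxx sub0seq.
  (* [c] is still on the stack when [d] is pushed. If [d] stays, the stack contains [c d c]; if [d]
     is popped, [c] may not be popped after it. *)
  rewrite -uE in s2; case: st3_dec => [[st3' st3E]|st30]; last first.
    have [_ aba3] := aba_free_cat aba'.
    suff /aba3/eqP : subseq [:: c; d; c] out3 by apply/negP.
    apply: subseq_trans sub3; move: stE; rewrite st30 /= => <-.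
    by rewrite /= !eqxx sub1seq (mem_subseq s2) // inE eqxx.
  have st2E : st2 = st3' ++ st4 by move: stE; rewrite st3E => -[].
  rewrite st2E in s2; have [[|a v1] [v2 [/= vE s3 s4]]] := subseq_catE s2.
    apply: next_open; last by exists st3'.
    by rewrite -vE in s4; apply: subseq_trans (subseq_cons _ _) s4.
  case: vE => aE; case: v1 s3 => [|a' v1] s3 vE; last first.
    case: vE => DE _; apply: cD; do 2!apply: subseq_trans _ (suffix_subseq _ _).
    rewrite st3E; apply: subseq_trans _ (subseq_cons _ _).
    by apply: subseq_trans s3; rewrite aE DE /= !eqxx sub0seq.
  have d3 : d \in out3.
    apply: d_later; rewrite inE; apply/orP; right.
    by apply: (mem_subseq s4); rewrite -[v2]vE !inE eqxx orbT.
  suff /(aba_later aba')/(_ d3) e : subseq [:: d; c] (out ++ st1 ++ st3).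
    by rewrite e eqxx in cd.
  do 2!apply: subseq_trans _ (suffix_subseq _ _).
  by rewrite st3E /= eqxx aE.
(* The output ends in [c], so popping [D] or [d] now would separate [c] from its later sock. *)
have c_out a u : subseq [:: a] u -> subseq [:: c; a] (out ++ u).
  by apply: sub_cons2; rewrite oE sub1seq mem_rcons inE eqxx.
have [[|a u1] [u2 [/= uE s1 s2]]] := subseq_catE sub.
  case: st3_dec => [[st3' st3E]|]; last by apply: next_closed; rewrite uE.
  apply: cdF; apply: c_out; apply: subseq_trans _ (suffix_subseq _ _).
  by rewrite st3E sub1seq inE eqxx.
case: uE => DE _; apply: cD; apply: c_out.
apply: subseq_trans _ (prefix_subseq _ _).
by apply: subseq_trans s1; rewrite DE sub1seq inE eqxx.
Qed.

End ChainWord.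

(** * Schedules for the tail after a deletion *)

Definition double_word (T : Type) (l : seq T) :=
  flatten [seq [:: a; a] | a <- l].

Section Schedules.
Variable T : eqType.
Implicit Types (a b c d D x : T) (ds st out o r l u v w xs : seq T).

Lemma disjointI u v : {in v, forall x, x \notin u} -> ~~ has (mem u) v.
Proof. by move=> vu; apply/hasPn => x /vu. Qed.

Lemma color_sorted_cat u v : color_sorted u -> color_sorted v ->
  ~~ has (mem u) v -> color_sorted (u ++ v).
Proof.
move=> su sv dis a; have [au|au] := boolP (a \in u).
  have [u1 [u2 [k [-> a1 a2]]]] := su a.
  exists u1, (u2 ++ v), k; split; rewrite ?catA // mem_cat negb_or a2 /=.
  by apply: contra dis => av; apply/hasP; exists a.
have [v1 [v2 [k [-> a1 a2]]]] := sv a.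
exists (u ++ v1), v2, k; split; rewrite ?catA // mem_cat negb_or au //.
Qed.

Lemma mem_double_word l : double_word l =i l.
Proof.
by elim: l => //= a l IH x; rewrite !inE IH; case: eqP.
Qed.

Lemma color_sorted_double l : uniq l -> color_sorted (double_word l).
Proof.
elim: l => [_|a l IH /= /andP[al ul]]; first exact/sortedbP.
apply: (@color_sorted_cat [:: a; a]); [|exact: IH|].
  by apply/sortedbP; rewrite /= eqxx.
apply: disjointI => x; rewrite mem_double_word; apply: contraTN.
by rewrite !inE orbb => /eqP->.
Qed.

Definition separated xs o r :=
  [/\ color_sorted o, color_sorted r, ~~ has (mem o) r & {subset o ++ r <= xs}].

(** The shape into which all outputs below embed: the auxiliary letters [r] left on the stack come
    out in one go, splitting the tail colors into [l1] and [l2]. *)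
Lemma color_sorted_interleave xs o r l1 l2 : separated xs o r ->
  uniq (xs ++ l1 ++ l2) ->
  color_sorted (o ++ double_word l1 ++ r ++ double_word l2).
Proof.
move=> [so sr dis sub]; rewrite !cat_uniq => /and5P[uxs dis1 u1 dis2 u2].
have xl x : x \in xs -> (x \notin l1) && (x \notin l2).
  move=> xx; rewrite -negb_or -mem_cat.
  by apply: contraTN (dis1) => xl; apply/negPn/hasP; exists x.
have ox x : x \in o -> x \in xs by move=> xo; apply: sub; rewrite mem_cat xo.
have rx x : x \in r -> x \in xs.
  by move=> xr; apply: sub; rewrite mem_cat xr orbT.
apply: color_sorted_cat => //.
  apply: color_sorted_cat (color_sorted_double u1) _ _.
    apply: color_sorted_cat (sr) (color_sorted_double u2) _.
    apply: disjointI => x; rewrite mem_double_word; apply: contraTN => /rx/xl.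
    by case/andP.
  apply: disjointI => x; rewrite mem_cat !mem_double_word.
  case/orP=> [/rx/xl/andP[] //|x2].
  by apply: contra dis2 => x1; apply/hasP; exists x.
apply: disjointI => x; rewrite !mem_cat !mem_double_word; apply: contraTN => xo.
rewrite !negb_or; have /andP[-> ->] := xl x (ox x xo); rewrite andbT /=.
by apply: contra dis => xr; apply/hasP; exists x.
Qed.

(** Pop [c], push [d], then push and pop [c]: now [d] has taken the place of [c] directly above the
    last letter. *)
Lemma chain_word_clean c ds : foot_run (chain_word c ds)
  (if ds is [::] then [:: c; c] else [:: c; last c ds]) (double_word (c :: ds)).
Proof.
elim: ds c => [|d ds IH] c /=; first exact: foot_run_pop_all.
do 4!constructor; have := IH d; case: ds {IH} => //.
Qed.

Lemma chain_word_missing_fst d c ds : foot_run (d :: c :: chain_word d ds)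
  [:: last d ds] (c :: double_word (d :: ds)).
Proof.
do 3!constructor; have := chain_word_clean d ds; case: ds => //.
Qed.

(** Here one [c] is already output and [a_0] is not on the stack. Each [d] is popped right after the
    second [c] and becomes the next open color; [r] waits until the end. *)
Lemma chain_word_missing_last c ds r : exists2 out,
  foot_run (chain_word c ds) r (out ++ r) &
  subseq (c :: out) (double_word (c :: ds)).
Proof.
elim: ds c => [|d ds IH] c.
  by exists [::]; [apply: foot_run_pop_all | rewrite /= eqxx].
have [out run sub] := IH d; exists [:: c, d & out]; first by do 4!constructor.
by move: sub; rewrite /= !eqxx.
Qed.

(** Colors are opened in turn up to the pair with the deleted sock. The deletion provides a moment
    without open color; [r] is popped then, and nothing is stuck above the last letter any more. *)
Lemma chain_word_delete c ds r u x v : chain_word c ds = u ++ x :: v ->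
  exists out l1 l2, [/\ foot_run (u ++ v) (r ++ [:: last c ds]) out,
    l1 ++ l2 = c :: ds &
    subseq (c :: out) (double_word l1 ++ r ++ double_word l2)].
Proof.
elim: ds c u => [|d ds IH] c u; first by case: u.
case: u => [|d' [|c' u]] /= [].
- move=> _ <- /=; exists (c :: r ++ (d :: double_word ds)), [:: c], (d :: ds).
  split=> //; last first.
    apply: (@cat_subseq _ [:: c; c] _ [:: c; c]) => //.
    by apply: cat_subseq => //; apply: subseq_cons.
  do 2!constructor; apply: foot_run_pops.
  case: ds {IH} => [|e ds] /=; first exact: foot_run_pop_all.
  exact: chain_word_missing_fst.
- move=> <- _ <- /=; exists (r ++ double_word (d :: ds)), [:: c], (d :: ds).
  split=> //; last exact: subseq_cons.
  apply: foot_run_pops; constructor; have := chain_word_clean d ds.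
  by case: ds {IH}.
- move=> <- <- E; have [out [l1 [l2 [run lE sub]]]] := IH _ _ E.
  exists [:: c, d & out], (c :: l1), l2; split.
  + by do 4!constructor.
  + by rewrite /= lE.
  + exact: (cat_subseq (subseq_refl [:: c; c]) sub).
Qed.

End Schedules.

(** * Reduction of the families to finite checks on the preludes *)

Definition all_configs (T : eqType) (s : seq T) : seq (seq T * seq T) :=
  flatten [seq pops d.1 d.2 | d <- configs s].

Definition map_config (T U : Type) (f : T -> U) (d : seq T * seq T) :=
  (map f d.1, map f d.2).

Section ConfigsMap.
Variables (T U : eqType) (f : T -> U).

Lemma pops_map (d : seq T * seq T) :
  pops (map f d.1) (map f d.2) = map (map_config f) (pops d.1 d.2).
Proof.
case: d => st out /=; elim: st out => [|x st IH] out //=.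
by rewrite -map_rcons IH.
Qed.

Lemma configs_map s : configs (map f s) = map (map_config f) (configs s).
Proof.
elim/last_ind: s => [|s x IH] //; rewrite map_rcons !configs_rcons IH.
rewrite map_flatten -!map_comp; congr flatten; apply: eq_map => d /=.
by rewrite /push_all /= pops_map -!map_comp.
Qed.

Lemma all_configs_map s :
  all_configs (map f s) = map (map_config f) (all_configs s).
Proof.
rewrite /all_configs configs_map map_flatten -!map_comp; congr flatten.
by apply: eq_map => d /=; apply: pops_map.
Qed.

End ConfigsMap.

Section AllConfigs.
Variable T : eqType.
Implicit Types (s q out : seq T) (d : seq T * seq T).

Lemma all_configs_run s d q out : d \in all_configs s -> foot_run q d.1 out ->
  foot_run (s ++ q) [::] (d.2 ++ out).
Proof.
move=> /flatten_mapP[c cs /popsP[st1 [cE ->]]] run.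
apply/foot_run_configs; exists c => //.
exists (st1 ++ out); last by rewrite catA.
by rewrite cE; apply: foot_run_pops.
Qed.

Lemma configs_all_configs s : {subset configs s <= all_configs s}.
Proof.
move=> d ds; apply/flatten_mapP; exists d => //; apply/popsP; exists [::].
by rewrite cats0.
Qed.

Lemma all_configs_perm s d : d \in all_configs s -> perm_eq (d.2 ++ d.1) s.
Proof.
move=> ds; have := all_configs_run ds (foot_run_pop_all d.1).
by move=> /foot_run_perm; rewrite !cats0.
Qed.

End AllConfigs.

Lemma sortedb_map (T U : eqType) (f : T -> U) s : {in s &, injective f} ->
  sortedb (map f s) = sortedb s.
Proof.
elim: s => // x s IH f_inj; rewrite map_cons /= IH; last first.
  by move=> a b as_ bs; apply: f_inj; rewrite inE ?as_ ?bs orbT.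
congr (_ && _).
have <- : (f x \in map f s) = (x \in s).
  apply/mapP/idP => [[z zs /f_inj-> //]|]; last by exists x.
    by rewrite inE eqxx.
  by rewrite inE zs orbT.
case: s f_inj {IH} => //= z s f_inj; congr (_ || _).
by apply: (inj_in_eq f_inj); rewrite !inE eqxx ?orbT.
Qed.

Definition settled k (o r : seq nat) :=
  [&& sortedb o, sortedb r, ~~ has (mem o) r & all (gtn k) (o ++ r)].

(* In the encoded preludes [0], ..., [k.-1] stand for the auxiliary letters,
   [k] for [a_0] and [k.+1] for [a_{n-1}]. *)
Definition closed_config k (st s : seq nat) :=
  has (fun d => (d.1 == st) && settled k d.2 [::]) (all_configs s).

(** No search for [r] and [o] is needed: the lengths determine them, as the stack ends in [tl] and
    the output in [a_{n-1}]. *)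
Definition open_config k (tl s : seq nat) :=
  has (fun d => let r := take (size d.1 - size tl) d.1 in
                let o := take (size d.2).-1 d.2 in
                (d == (r ++ tl, rcons o k.+1)) && settled k o r)
      (all_configs s).

(* Either completing the output would split a color, or [D] is stuck as in
   [chain_word_stuck]. *)
Definition stuck_config k (d : seq nat * seq nat) :=
  [|| ~~ sortedb (d.2 ++ d.1), ~~ sortedb (rcons d.2 k),
      ~~ sortedb (rcons d.2 k.+1) |
      has (fun D => subseq [:: k.+1; D; k] d.1 ||
                    (d.2 == rcons (take (size d.2).-1 d.2) k.+1) &&
                    subseq [:: D; k] d.1) (iota 0 k)].

Definition delete (T : Type) i (s : seq T) := take i s ++ drop i.+1 s.

(** The third check serves deletions in the tail. The alternatives of the last one prepare
    [chain_word_clean], [chain_word_missing_fst] and [chain_word_missing_last]. *)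
Definition prelude_ok k (s : seq nat) :=
  [&& all (gtn k.+2) s, all (stuck_config k) (configs s),
      open_config k [:: k] s &
      all (fun i => let s' := delete i s in
             [|| closed_config k [:: k.+1; k] s', closed_config k [:: k] s'
               | open_config k [::] s']) (iota 0 (size s))].

Definition preludes : seq (nat * seq nat) :=
  [:: (2, [:: 0; 2; 1; 3; 0]); (2, [:: 2; 0; 1; 3; 0; 1]);
      (2, [:: 2; 1; 0; 3; 0; 1]); (3, [:: 3; 0; 4; 1; 2; 1; 0])].

Lemma preludes_ok : all (fun p => prelude_ok p.1 p.2) preludes.
Proof. by vm_compute. Qed.

Section Families.
Variables (T : eqType) (x0 : T) (k : nat) (H : seq nat) (xs : seq T) (c : T).
Variable ds : seq T.
Hypotheses (H_ok : prelude_ok k H) (ds_neq0 : ds != [::])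
  (letters_uniq : uniq (xs ++ c :: ds)) (size_xs : size xs = k).
Let b := last c ds.
Let f := nth x0 (xs ++ [:: b; c]).

Let b_ds : b \in ds.
Proof.
by rewrite /b; case: (ds) ds_neq0 => // d ds' _; exact: mem_last d ds'.
Qed.

Let ls_uniq : uniq (xs ++ [:: b; c]).
Proof.
move: letters_uniq; rewrite !cat_uniq /= !inE => /and4P[-> dis cds _] /=.
rewrite andbT; move: dis; rewrite !negb_or => /andP[-> dis] /=.
have -> : b \notin xs by apply: contra dis => bxs; apply/hasP; exists b.
by apply: contraNneq cds => <-.
Qed.

Let f_inj i j : i < k.+2 -> j < k.+2 -> f i = f j -> i = j.
Proof.
move=> ik jk /eqP; rewrite nth_uniq // ?size_cat ?size_xs ?addn2 //.
by move/eqP.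
Qed.

Let f_b : f k = b.
Proof. by rewrite /f nth_cat size_xs ltnn subnn. Qed.

Let f_c : f k.+1 = c.
Proof. by rewrite /f nth_cat size_xs ltnNge leqnSn subSnn. Qed.

Let f_xs i : i < k -> f i \in xs.
Proof. by move=> ik; rewrite /f nth_cat size_xs ik mem_nth // size_xs. Qed.

Let inj_on (s : seq nat) : all (gtn k.+2) s -> {in s &, injective f}.
Proof. by move=> /allP sk i j /sk ik /sk jk; apply: f_inj. Qed.

Let settled_separated o r : settled k o r -> separated xs (map f o) (map f r).
Proof.
case/and4P=> so sr dis ork.
have ork2 : all (gtn k.+2) (o ++ r).
  by apply: sub_all ork => i /= ik; apply: leq_trans ik _; lia.
have := ork2; rewrite all_cat => /andP[ok rk].
split; try by apply/sortedbP; rewrite sortedb_map //; apply: inj_on.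
  apply: disjointI => _ /mapP[i ir ->]; apply/mapP => -[j jo].
  move/(f_inj (allP rk i ir) (allP ok j jo)) => ij.
  by case/hasP: dis; exists i => //; rewrite ij.
move=> x; rewrite -map_cat => /mapP[i /(allP ork) ik ->].
exact: f_xs.
Qed.

Let done_sortable s q d l1 l2 o r out : d \in all_configs s ->
  settled k o r -> foot_run q (map f d.1) out -> l1 ++ l2 = c :: ds ->
  subseq (map f d.2 ++ out)
    (map f o ++ double_word l1 ++ map f r ++ double_word l2) ->
  foot_sortable (map f s ++ q).
Proof.
move=> ds' sep run lE sub; exists (map f d.2 ++ out).
  have d_f : map_config f d \in all_configs (map f s).
    by rewrite all_configs_map map_f.
  exact: all_configs_run d_f run.
apply: color_sorted_subseq sub _.
apply: color_sorted_interleave (settled_separated sep) _.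
by rewrite lE.
Qed.

Lemma family_delete_prelude i : i < size H ->
  foot_sortable (map f (delete i H) ++ chain_word c ds).
Proof.
case/and4P: H_ok => _ _ _ /allP/(_ i); rewrite mem_iota => /(_ _) del iH.
case/or3P: (del iH) => /hasP[[st out] ds'] /=.
- move=> /andP[/eqP stE sep].
  apply: (done_sortable ds' sep (l1 := c :: ds) (l2 := [::])
            (out := double_word (c :: ds))); rewrite ?cats0 //= stE /= f_c f_b.
  by have := chain_word_clean c ds; rewrite /b; case: (ds) ds_neq0.
- move=> /andP[/eqP stE sep].
  apply: (done_sortable ds' sep (l1 := c :: ds) (l2 := [::])
            (out := c :: double_word ds)); rewrite ?cats0 //= ?stE /= ?f_b.
    rewrite /b; case: (ds) ds_neq0 => // d ds1 _ /=.
    exact: chain_word_missing_fst.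
  by rewrite cat_subseq // subseq_cons.
- set r := take _ _; set o := take _ _ => /andP[/eqP[stE outE] sep].
  rewrite cats0 in stE.
  have [out' run sub] := chain_word_missing_last c ds (map f r).
  apply: (done_sortable ds' sep (l1 := c :: ds) (l2 := [::])
            (out := out' ++ map f r)).
  + by rewrite /= stE.
  + by rewrite cats0.
  + rewrite -[(st, out).2]/out outE map_rcons f_c cat_rcons cats0.
    exact: cat_subseq (subseq_refl _) (cat_subseq sub (subseq_refl _)).
Qed.

Lemma family_delete_tail u x v : chain_word c ds = u ++ x :: v ->
  foot_sortable (map f H ++ u ++ v).
Proof.
move=> E; case/and4P: H_ok => _ _ /hasP[[st out] ds' /=].
set r := take _ _; set o := take _ _ => /andP[/eqP[stE outE] sep] _.
have [out' [l1 [l2 [run lE sub]]]] := chain_word_delete (map f r) E.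
apply: (done_sortable ds' sep _ lE) => /=.
  by rewrite stE map_cat /= f_b; exact: run.
by rewrite outE map_rcons f_c cat_rcons; apply: cat_subseq.
Qed.

Lemma family_minimal : ~ foot_sortable (map f H ++ chain_word c ds) ->
  minimal_non_foot_sortable (map f H ++ chain_word c ds).
Proof.
move=> ns; split=> // u v x E.
have [lt|le] := ltnP (size u) (size H).
  have uE : u = map f (take (size u) H).
    have := congr1 (take (size u)) E.
    by rewrite take_cat size_map lt take_size_cat // map_take.
  have vE : v = map f (drop (size u).+1 H) ++ chain_word c ds.
    have := congr1 (drop (size u).+1) E.
    rewrite -cat_rcons (drop_size_cat v) ?size_rcons // drop_cat size_map.
    case: ltnP => [_ <-|ge <-]; first by rewrite map_drop.
    have -> : (size u).+1 = size H by apply/eqP; rewrite eqn_leq lt.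
    by rewrite subnn drop0 drop_size.
  by rewrite uE vE catA -map_cat; apply: family_delete_prelude.
have uE : u = map f H ++ drop (size H) u.
  have := congr1 (take (size H)) E; rewrite take_size_cat ?size_map //.
  by rewrite takel_cat // => ->; rewrite cat_take_drop.
rewrite uE -catA; apply: (@family_delete_tail _ x).
move: E; rewrite {1}uE -catA => /(congr1 (drop (size (map f H)))).
by rewrite !drop_size_cat.
Qed.

(** The run is cut after the prelude. The first three clauses of [stuck_config] exhibit an unsorted
    subsequence of every completed output; the last one feeds [chain_word_stuck]. *)
Lemma family_not_sortable : ~ foot_sortable (map f H ++ chain_word c ds).
Proof.
case=> out run so; have aba := color_sorted_aba so.
have [_ [_ dis cds uds]] : True /\
    [/\ uniq xs, ~~ has (mem xs) (c :: ds), uniq (c :: ds) & True].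
  by move: letters_uniq; rewrite cat_uniq => /and3P[].
case/foot_run_configs: run => d'; rewrite configs_map => /mapP[d dH ->] {d'}.
move=> [out2 /= run outE].
case/and4P: H_ok => Hk /allP/(_ d dH) stuck _ _.
have dk : all (gtn k.+2) (d.2 ++ d.1).
  by rewrite (perm_all _ (all_configs_perm (configs_all_configs dH))).
have := dk; rewrite all_cat => /andP[d2k d1k].
have viol (s : seq nat) : all (gtn k.+2) s -> subseq (map f s) out -> sortedb s.
  move=> sk sub; rewrite -(sortedb_map (inj_on sk)).
  by apply/sortedbP; apply: color_sorted_subseq so.
have viol_rcons i : i < k.+2 -> f i \in chain_word c ds ->
    sortedb (rcons d.2 i).
  move=> ik iq; apply: viol; first by rewrite all_rcons /= ik.
  rewrite map_rcons -cats1 outE; apply: cat_subseq => //.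
  by rewrite sub1seq (perm_mem (foot_run_perm run)) mem_cat iq.
have c_later : c \in chain_word c ds.
  by case: (ds) ds_neq0 => // e ds' _; rewrite /= !inE eqxx orbT.
have b_later : b \in chain_word c ds.
  have bc : c != b by case/andP: cds => cds _; apply: contraNneq cds => ->.
  have := count_chain_word b c ds; rewrite -/b eqxx /= (negPf bc).
  have : 0 < count_mem b ds by rewrite -has_count has_pred1.
  by rewrite -has_pred1 has_count; clear; lia.
case/or4P: stuck.
- rewrite viol // map_cat outE; apply: cat_subseq => //.
  exact: foot_run_stack_subseq run.
- by rewrite viol_rcons ?f_b.
- by rewrite viol_rcons ?f_c.
case/hasP=> D; rewrite mem_iota /= => Dk stuck.
have fD : f D \notin c :: ds.
  by apply: contra dis => Dc; apply/hasP; exists (f D) => //; apply: f_xs.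
apply: (chain_word_stuck (out := map f d.2) fD cds run); first by rewrite -outE.
case/orP: stuck => [/(map_subseq f)|/andP[/eqP-> /(map_subseq f)]] /=.
  by rewrite f_b f_c; left.
rewrite f_b => sub; right; exists (map f (take (size d.2).-1 d.2)) => //.
by rewrite map_rcons f_c.
Qed.

End Families.

Lemma prelude_encode (T : eqType) (x0 b c : T) (xs H : seq T) :
  prelude b c xs H -> exists2 H0, (size xs, H0) \in preludes &
                      H = map (nth x0 (xs ++ [:: b; c])) H0.
Proof.
case=> [x y|x y|x y|x y z].
- by exists [:: 0; 2; 1; 3; 0].
- by exists [:: 2; 0; 1; 3; 0; 1].
- by exists [:: 2; 1; 0; 3; 0; 1].
- by exists [:: 3; 0; 4; 1; 2; 1; 0].
Qed.

Lemma count_prelude (T : eqType) (a b c : T) (xs H : seq T) :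
  prelude b c xs H ->
  count_mem a H <= (b == a) + (c == a) + (count_mem a xs).*2.
Proof. by case=> *; rewrite /=; lia. Qed.

Lemma family_two_bounded_minimal (T : eqType) (a : nat -> T) n xs H : 2 <= n ->
  prelude (a 0) (a n.-1) xs H -> uniq (xs ++ mkseq a n) ->
  two_bounded (H ++ tail_word a n) /\
  minimal_non_foot_sortable (H ++ tail_word a n).
Proof.
case: n => [|[|n]] // _ pre; rewrite tail_word_zigzag.
set l := mkseq a n.+2 => u; set c := a n.+1 in pre *.
(* [mkseq] starts from [a_0], whereas [chain_word] starts from [a_{n-1}]. *)
have lE : rev l = c :: rev (mkseq a n.+1) by rewrite /l mkseqS rev_rcons.
set ds := rev (mkseq a n.+1) in lE.
have dsE : last c ds = a 0.
  by rewrite /ds /mkseq /= rev_cons last_rcons.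
have ds_neq0 : ds != [::] by rewrite -size_eq0 size_rev size_mkseq.
have uds : uniq (xs ++ c :: ds).
  rewrite -lE (perm_uniq (s2 := xs ++ l)) // perm_cat2l perm_rev.
  exact: perm_refl.
rewrite -[l]revK lE zigzag_rev; split.
  move=> z; rewrite count_cat.
  have := count_prelude z pre; have := count_chain_word z c ds.
  have : count_mem z (xs ++ c :: ds) <= 1.
    by rewrite count_uniq_mem //; case: (_ \in _).
  by rewrite dsE count_cat; clear; lia.
have [H0 H0_in HE] := prelude_encode (a 0) pre.
have H0_ok := allP preludes_ok _ H0_in; rewrite HE -dsE.
apply: (family_minimal H0_ok ds_neq0 uds (erefl _)).
exact: (family_not_sortable H0_ok ds_neq0 uds (erefl _)).
Qed.

Lemma sporadic_two_bounded_minimal w : w \in sporadic ->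
  two_bounded w /\ minimal_non_foot_sortable w.
Proof.
move=> w_in.
have /allP/(_ w w_in)/and3P[/allP tb ns /allP del] : all (fun w =>
    [&& all (fun x => count_mem x w <= 2) w, ~~ sortableb w &
        all (fun i => sortableb (delete i w)) (iota 0 (size w))]) sporadic.
  by vm_compute.
split.
  by move=> x; have [/tb //|/count_memPn->] := boolP (x \in w).
split=> [/sortableP|u v x wE]; first by apply/negP.
have := del (size u); rewrite mem_iota wE size_cat /= -addSnnS leq_addr.
rewrite /delete take_size_cat // -cat_rcons drop_size_cat ?size_rcons //.
by move=> /(_ isT)/sortableP.
Qed.

Lemma listed_two_bounded_minimal w : listed w ->
  two_bounded w /\ minimal_non_foot_sortable w.
Proof.
case=> {w} [w|x y a n n2|x y a n n3|x y a n n3|x y z a n n3].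
- exact: sporadic_two_bounded_minimal.
- exact: (family_two_bounded_minimal n2 (prelude_A _ _ x y)).
- exact: (family_two_bounded_minimal (ltnW n3) (prelude_B _ _ x y)).
- exact: (family_two_bounded_minimal (ltnW n3) (prelude_B' _ _ x y)).
- exact: (family_two_bounded_minimal (ltnW n3) (prelude_C _ _ x y z)).
Qed.

Theorem theorem1p1 (T : eqType) (s : seq T) :
  (two_bounded s /\ minimal_non_foot_sortable s) <->
  (exists2 w : seq nat, listed w & renaming w s).
Proof.
split=> [[tb min]|[w /listed_two_bounded_minimal[tb min] ren]]; last first.
  split; first exact: renaming_two_bounded ren tb.
  exact: renaming_minimal ren min.
(* The empty word is sortable, so [s] has a letter to serve as default. *)
have x0 : T.
  case: s min {tb} => [[ns _]|//]; exfalso; apply: ns.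
  by exists [::]; [constructor | apply/sortedbP].
have [so|[v [w lw ren] occ]] := sortable_or_bad x0 tb; first by case: min.
have [_ [ns _]] := listed_two_bounded_minimal lw.
(* The listed word found inside [s] is not sortable, so by minimality it is all of [s]. *)
have <- : v = s; last by exists w.
apply: minimal_subseq min (occurs_subseq (leqnn _) occ) _.
by move/(renaming_foot_sortable ren).
Qed.
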